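(* Let $G$ be a hyperbolic group endowed with a word metric $d_G$ and let $\mu_0$ be a probability measure with finite first moment on $G$ whose support generates a non-elementary semigroup of $G$. Then there exist a neighborhood $\mathcal{N}$ of $\mu_0$ and a constant $C\ge1$ such that for every $\mu\in\mathcal{N}$ the random walk $(Z_n)$ with driving measure $\mu$ satisfies the following: for each $t\ge0$, each $M\ge1$ and all positive integers $k\le n$, $$\mathbb{P}^\mu\Big[\sup_{[id,Z_n]}d_G(Z_k,[id,Z_n])\ge t\Big]\le Ce^{-M/C}+M^2\big(\mathbb{P}^\mu[d_G(id,X_1)\ge(t-C)/M]\big)^2,$$ where the supremum is over all geodesics $[id,Z_n]$ from $id$ to $Z_n$. Moreover, if $\mu$ has finite second moment, then $\mu$ satisfies the $p$-th moment deviation inequality (in the metric $d_G$) for each $p<4$, i.e. $\sup_{n,m\in\mathbb{N}}\mathbb{E}^\mu\big[(id,Z_{n+m})_{Z_n}^p\big]<\infty$.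
   Context: Under $\mathbb{P}^\mu$ (expectation $\mathbb{E}^\mu$), $X_1,X_2,\dots$ are i.i.d. of law $\mu$, $Z_0=id$, $Z_n=X_1\cdots X_n$. Finite $p$-th moment: $\sum_xd_G(id,x)^p\mu(x)<\infty$. Gromov product: $(x,y)_w=\frac12(d_G(w,x)+d_G(w,y)-d_G(x,y))$. A sub-semigroup of $G$ is non-elementary if it contains two loxodromic elements (for the action on the Cayley graph, i.e. infinite-order elements) that freely generate a free group; the semigroup generated by the support is the smallest sub-semigroup containing it. For probability measures on $G$ with the same support, $\mathbf{n}(\mu,\mu_0)=\sup_a\max\big(\frac{\mu(a)}{\mu_0(a)},\frac{\mu_0(a)}{\mu(a)}\big)-1$ (sup over the support); $\mathbf{n}=\infty$ if the supports differ. A neighborhood of $\mu_0$ is a set $\{\mu:\mathbf{n}(\mu,\mu_0)\le K\}$ with $K>0$. *)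

(* Defs.v *)
From HB Require Import structures.
From mathcomp Require Import all_boot all_order all_algebra.
From mathcomp Require Import finmap.
From mathcomp Require Import all_classical all_reals all_analysis.

Set Implicit Arguments.
Unset Strict Implicit.
Unset Printing Implicit Defensive.

Import Order.TTheory GRing.Theory Num.Theory.

Local Open Scope classical_set_scope.
Local Open Scope ring_scope.

(* [discrete G] is [G] with the sigma-algebra of all subsets. *)
Definition discrete (G : groupType) : Type := G.
HB.instance Definition _ (G : groupType) := Group.on (discrete G).
HB.instance Definition _ (G : groupType) :=
  isPointed.Build (discrete G) (1%g : G).
HB.instance Definition _ (G : groupType) :=
  @isMeasurable.Build default_measure_display (discrete G)
    (@discrete_measurable G) (@discrete_measurable0 G)
    (@discrete_measurableC G) (@discrete_measurableU G).

Section word_metric.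
Context {G : groupType}.
Implicit Types (S : seq G) (g x y z w : G).

Definition expressible S (n : nat) g : Prop :=
  exists s : seq G, [/\ size s = n,
    all (fun a => (a \in S) || ((a^-1)%g \in S)) s & (\prod_(a <- s) a)%g = g].

Definition generates S : Prop := forall g, exists n, expressible S n g.

(* The value is meaningful for a generating [S]; a [g] that is not a product of
   letters gets length 0. *)
Definition word_length S g : nat :=
  if pselect (exists n, `[< expressible S n g >]) is left ex then ex_minn ex
  else 0%N.

Definition word_dist S x y : nat := word_length S (x^-1 * y)%g.

(* Geodesics of the Cayley graph between two vertices, as lists of successive
   vertices. A point inside an edge is never closer to a vertex than both
   endpoints of that edge, so distances from vertices to a geodesic are attained
   at its vertices. *)
Definition geodesics S x y : set (seq G) :=
  [set s | let d := word_dist S x y in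
    [/\ size s = d.+1, nth 1%g s 0 = x, nth 1%g s d = y &
     forall i j, (i <= j <= d)%N ->
       word_dist S (nth 1%g s i) (nth 1%g s j) = (j - i)%N]].

Variable R : realType.

Definition dist_to S z (s : seq G) : \bar R :=
  ereal_inf [set ((word_dist S z v)%:R)%:E | v in [set` s]].

Definition geodesic_deviation S z x y : \bar R :=
  ereal_sup [set dist_to S z s | s in geodesics S x y].

Definition gromov_product S w x y : R :=
  ((word_dist S w x)%:R + (word_dist S w y)%:R - (word_dist S x y)%:R) / 2.

(* Gromov's four-point condition for the metric space (G, d_S) *)
Definition gromov_hyperbolic S : Prop :=
  exists delta : R, forall w x y z,
    Num.min (gromov_product S w x y) (gromov_product S w y z) - delta
      <= gromov_product S w x z.

End word_metric.

Section semigroups.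
Context {G : groupType}.
Implicit Types (g h : G) (H : set G).

Definition subsemigroup H : Prop := forall g h, H g -> H h -> H (g * h)%g.

Definition semigroup_generated (A : set G) : set G := smallest subsemigroup A.

(* The loxodromic elements of a hyperbolic group, for the action on its Cayley
   graph, are those of infinite order. *)
Definition loxodromic g : Prop := forall n, (0 < n)%N -> (g ^+ n)%g <> 1%g.

(* A letter is a pair (generator, sign): (true, true), (true, false),
   (false, true), (false, false) stand for g, g^-1, h, h^-1. *)
Definition letter_eval g h (a : bool * bool) : G :=
  let s := if a.1 then g else h in if a.2 then s else (s^-1)%g.

Definition reduced (s : seq (bool * bool)) : bool :=
  sorted (fun a b => b != (a.1, ~~ a.2)) s.

Definition freely_generate g h : Prop :=
  forall s, reduced s -> s <> [::] -> (\prod_(a <- s) letter_eval g h a)%g <> 1%g.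

Definition nonelementary H : Prop :=
  exists g h, [/\ H g, H h, loxodromic g, loxodromic h & freely_generate g h].

End semigroups.

Section measures_on_groups.
Context {G : groupType} {R : realType}.
Implicit Types (mu nu : probability (discrete G) R) (S : seq G).

Definition msupport mu : set G := [set g | mu [set g] != 0%E].

Definition finite_moment S (p : R) mu : Prop :=
  (\esum_(x in [set: G])
     (((word_dist S 1%g x)%:R `^ p)%:E * mu [set x]) < +oo)%E.

Definition mass_ratio mu nu (a : G) : R :=
  fine (mu [set a]) / fine (nu [set a]).

Definition discrepancy mu nu : \bar R :=
  if `[< msupport mu = msupport nu >] then
    (ereal_sup [set (Num.max (mass_ratio mu nu a) (mass_ratio nu mu a))%:E
                | a in msupport nu] - 1)%E
  else +oo%E.

Definition neighborhood (mu0 : probability (discrete G) R) (K : R) :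
    set (probability (discrete G) R) :=
  [set mu | (discrepancy mu mu0 <= K%:E)%E].

End measures_on_groups.

Section random_walk.
Context {G : groupType} {R : realType}.
Context {d : measure_display} {Omega : measurableType d}.
Variables (P : probability Omega R) (mu : probability (discrete G) R).
Variable X : nat -> {mfun Omega >-> discrete G}.

Definition mutually_independent : Prop :=
  forall (J : {fset nat}) (A : nat -> set (discrete G)),
    (forall i, measurable (A i)) ->
    P (\bigcap_(i in [set` J]) X i @^-1` A i) =
      (\prod_(i <- J) P (X i @^-1` A i))%E.

Definition iid_of_law : Prop :=
  mutually_independent /\
  forall i (A : set (discrete G)), measurable A -> distribution P (X i) A = mu A.

(* The increments are indexed from 0: [X i] is X_(i+1), so that
   [walk n] is X_1 X_2 ... X_n. *)
Definition walk (n : nat) (omega : Omega) : G := (\prod_(i < n) X i omega)%g.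

Definition moment_deviation_inequality (S : seq G) (p : R) : Prop :=
  (ereal_sup [set 'E_P[fun omega =>
      (gromov_product R S (walk nm.1 omega) 1%g
         (walk (nm.1 + nm.2)%N omega) `^ p)%R]
    | nm in [set: nat * nat]] < +oo)%E.

End random_walk.

(* Main.v *)
(** Let o be the origin and (a, b)_w the Gromov product. Seen from Z_k, the two
    parts of the path are independent walks with endpoints a = Z_k^-1 and
    b = Z_k^-1 Z_n, and d(Z_k, [id, Z_n]) is (a, b)_o up to a constant. If
    (a, b)_o is larger than C plus the size of the first M positions of the walk
    to b, then (a, b)_z >= C for every such position z. For a fixed this has
    probability at most C exp(-M/C), whatever the tails of the measure, by
    Gouezel's pivot method: a fixed proportion of the blocks of the walk are
    Schottky elements, and conditionally on the other blocks, a point z with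
    (a, b)_z < C is missing only with exponentially small probability. Hence,
    outside of such events, both walks jump by at least (t - C)/M in their first
    M steps, which by independence costs M^2 P(|X_1| >= (t - C)/M)^2.

    A Schottky family is found by counting: if all 2^n positive words f of length
    n in two free generators moved a far point x into finitely many shadows, then
    the translates f p of one point p of [o, x] would lie in linearly many (in n)
    bounded balls. So positive words can be chosen one after the other with
    (f_i x, f_j x)_o bounded, for x as far as desired; no dynamics on the
    boundary and no positivity of translation lengths is needed.

    The moments follow from the tail bound at t = exp(j), with M = 4 C (j + 1). *)

Require Import Defs.
From HB Require Import structures.
From mathcomp Require Import all_boot all_order all_algebra.
From mathcomp Require Import finmap.
From mathcomp Require Import all_classical all_reals all_analysis.
From mathcomp Require Import measurable_realfun.
From mathcomp Require Import zify ring lra.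

Set Implicit Arguments.
Unset Strict Implicit.
Unset Printing Implicit Defensive.

Import Order.TTheory GRing.Theory Num.Theory.
Local Open Scope classical_set_scope.
Local Open Scope ring_scope.

(** * Word metrics and Gromov products *)

Section word_length_theory.
Context {G : groupType} {S : seq G}.
Hypothesis genS : generates S.
Implicit Types (g h : G) (n : nat).

Lemma expressible_word_length g : expressible S (word_length S g) g.
Proof.
rewrite /word_length; case: pselect => [ex|nex].
  by case: ex_minnP => n /asboolP.
by exfalso; apply: nex; have [n gn] := genS g; exists n; apply/asboolP.
Qed.

Lemma word_length_min n g : expressible S n g -> (word_length S g <= n)%N.
Proof.
move=> gn; rewrite /word_length; case: pselect => [ex|//].
by case: ex_minnP => m _; apply; apply/asboolP.
Qed.

Lemma expressibleM m n g h :
  expressible S m g -> expressible S n h -> expressible S (m + n) (g * h)%g.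
Proof.
move=> [s [sm sS <-]] [t [tn tS <-]]; exists (s ++ t).
by rewrite size_cat sm tn all_cat sS tS big_cat.
Qed.

Lemma expressibleV n g : expressible S n g -> expressible S n (g^-1)%g.
Proof.
move=> [s [<- + <-]]; elim: s => [_|a s IH /= /andP[aS sS]].
  by exists [::]; rewrite !big_nil invg1.
rewrite big_cons invgM -addn1; apply: expressibleM (IH sS) _.
by exists [:: a^-1%g]; rewrite big_seq1 /= invgK orbC aS.
Qed.

Lemma word_length1 : word_length S 1%g = 0%N.
Proof.
by apply/eqP; rewrite -leqn0; apply: word_length_min; exists [::]; rewrite big_nil.
Qed.

Lemma word_lengthV g : word_length S (g^-1)%g = word_length S g.
Proof.
suff wle h : (word_length S (h^-1)%g <= word_length S h)%N.
  by apply/eqP; rewrite eqn_leq wle -{1}[g]invgK wle.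
exact/word_length_min/expressibleV/expressible_word_length.
Qed.

Lemma word_lengthM g h :
  (word_length S (g * h)%g <= word_length S g + word_length S h)%N.
Proof.
by apply/word_length_min/expressibleM; exact: expressible_word_length.
Qed.

Lemma word_length_prefix g n : (n <= word_length S g)%N ->
  exists p, word_length S p = n /\ word_length S (p^-1 * g)%g = (word_length S g - n)%N.
Proof.
move=> nle; have [s [sz sS gE]] := expressible_word_length g.
pose p := (\prod_(a <- take n s) a)%g; pose q := (\prod_(a <- drop n s) a)%g.
have pq : (p * q)%g = g by rewrite /p /q -big_cat cat_take_drop.
have sS' : all (fun a => (a \in S) || ((a^-1)%g \in S)) (take n s ++ drop n s).
  by rewrite cat_take_drop.
move: sS'; rewrite all_cat => /andP[tS dS].
have ple : (word_length S p <= n)%N.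
  by apply: word_length_min; exists (take n s); rewrite size_takel ?sz.
have qle : (word_length S q <= word_length S g - n)%N.
  by apply: word_length_min; exists (drop n s); rewrite size_drop sz.
have := word_lengthM p q; rewrite pq => tri.
by exists p; rewrite -pq mulKg pq; split; lia.
Qed.

Definition letters : seq G := S ++ [seq a^-1%g | a <- S].

Lemma mem_letters a : ((a \in S) || ((a^-1)%g \in S)) = (a \in letters).
Proof.
rewrite mem_cat; congr orb; apply/idP/mapP => [aS|[b bS ->]]; last by rewrite invgK.
by exists (a^-1)%g; rewrite ?invgK.
Qed.

Fixpoint sphere_words n : seq G :=
  if n is m.+1 then [seq (a * b)%g | a <- letters, b <- sphere_words m] else [:: 1%g].

Lemma mem_sphere_words n g : expressible S n g -> g \in sphere_words n.
Proof.
elim: n g => [|n IH] g [s [sz sS <-]].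
  by rewrite (size0nil sz) big_nil inE.
case: s sz sS => // a s [sz] /= /andP[aS sS].
rewrite big_cons; apply: allpairs_f; first by rewrite -mem_letters.
by apply: IH; exists s.
Qed.

Lemma ball_finite n : exists B : seq G, forall g, (word_length S g <= n)%N -> g \in B.
Proof.
exists (flatten [seq sphere_words i | i <- iota 0 n.+1]) => g gn.
apply/flattenP; exists (sphere_words (word_length S g)).
  by apply: map_f; rewrite mem_iota /= add0n ltnS.
exact/mem_sphere_words/expressible_word_length.
Qed.

(** Countability of G, through words in finitely many letters; values may repeat. It turns integrals
    over G into series. *)
Lemma generated_enum : exists e : nat -> G, forall g, exists n, e n = g.
Proof.
pose w (t : seq 'I_(size letters)) := (\prod_(i <- t) nth 1 letters i)%g.
exists (fun n => if choice.unpickle n is Some t then w t else 1%g) => g.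
have [s [_ sS <-]] := expressible_word_length g.
suff [t ->] : exists t, (\prod_(a <- s) a)%g = w t.
  by exists (choice.pickle t); rewrite choice.pickleK.
elim: s sS => [|a s IH] /=; first by exists [::]; rewrite /w !big_nil.
rewrite mem_letters => /andP[aS /IH[t tE]].
have ai : (index a letters < size letters)%N by rewrite index_mem.
by exists (Ordinal ai :: t); rewrite /w !big_cons nth_index // tE.
Qed.

End word_length_theory.

Section gromov_product_theory.
Context {R : realType} {G : groupType} {S : seq G}.
Hypothesis genS : generates S.
Implicit Types (w x y z g : G).

Local Notation len g := ((word_length S g)%:R : R).
Local Notation gp := (gromov_product R S).

Lemma gp1E x y : gp 1%g x y = (len x + len y - len (x^-1 * y)%g) / 2.
Proof. by rewrite /gromov_product /word_dist invg1 !mul1g. Qed.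

Lemma gp_translate g w x y : gp (g * w)%g (g * x)%g (g * y)%g = gp w x y.
Proof. by rewrite /gromov_product /word_dist !invgM !mulgA !mulgVK. Qed.

Lemma gpE w x y : gp w x y = gp 1%g (w^-1 * x)%g (w^-1 * y)%g.
Proof. by rewrite -(gp_translate (w^-1)%g w) mulVg. Qed.

Lemma lenV g : len (g^-1)%g = len g.
Proof. by rewrite word_lengthV. Qed.

Lemma lenM g h : len (g * h)%g <= len g + len h.
Proof. by rewrite -natrD ler_nat word_lengthM. Qed.

Lemma len_ge0 g : 0 <= len g. Proof. exact: ler0n. Qed.

Lemma len1 : len 1%g = 0. Proof. by rewrite word_length1. Qed.

Lemma lenVM g h : len (g^-1 * h)%g = len (h^-1 * g)%g.
Proof. by rewrite -lenV invgM invgK. Qed.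

Lemma lenB g h : len g - len h <= len (g^-1 * h)%g.
Proof.
have := lenM h (h^-1 * g)%g; rewrite mulVKg lenVM; lra.
Qed.

Lemma gpC w x y : gp w x y = gp w y x.
Proof. by rewrite /gromov_product /word_dist (lenVM x) (addrC (len (w^-1 * x)%g)). Qed.

Lemma gp_ge0 w x y : 0 <= gp w x y.
Proof.
rewrite gpE gp1E; set a := (w^-1 * x)%g; set b := (w^-1 * y)%g.
by have := lenM (a^-1)%g b; rewrite lenV; lra.
Qed.

Lemma gp_le_len x y : gp 1%g x y <= len y.
Proof. by rewrite gp1E; have := lenB x y; lra. Qed.

Lemma gpx1 x : gp 1%g x 1%g = 0.
Proof. by rewrite gp1E mulg1 len1 lenV; lra. Qed.

Lemma gpxx w x : gp w x w = 0.
Proof. by rewrite gpE mulVg gpx1. Qed.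

(** In the triangle 1, x, xy the Gromov products at the two ends of [1, x] add up to its length;
    translation by x^-1 brings the one at x to the origin. *)
Lemma gp_len_split x y : gp 1%g (x^-1)%g y = len x - gp 1%g x (x * y)%g.
Proof. by rewrite !gp1E mulKg invgK lenV; lra. Qed.

Lemma gp_base_le w x y : gp 1%g x y <= gp w x y + len w.
Proof.
rewrite (gpE w) !gp1E invgM invgK mulgA mulgK.
by have := lenB x w; have := lenB y w; rewrite 2!(lenVM _ w); lra.
Qed.

Lemma gp_perturb x x' y : gp 1%g x y <= gp 1%g x' y + len (x^-1 * x')%g.
Proof.
rewrite !gp1E; have := lenB x x'.
have := lenM (x'^-1 * x)%g (x^-1 * y)%g; rewrite -mulgA mulVKg lenVM; lra.
Qed.

Lemma hyperbolic_delta : gromov_hyperbolic R S -> exists delta : R, 0 <= delta /\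
  forall w x y z, Num.min (gp w x y) (gp w y z) <= gp w x z + delta.
Proof.
move=> [d hd]; exists (Num.max d 0); split; first by rewrite le_max lexx orbT.
move=> w x y z; have := hd w x y z; rewrite lerBlDr => /le_trans; apply.
by rewrite lerD2l le_max lexx.
Qed.

End gromov_product_theory.

Section hyperbolic_geometry.
Context {R : realType} {G : groupType} {S : seq G}.
Hypothesis genS : generates S.
Variable delta : R.
Local Notation len g := ((word_length S g)%:R : R).
Local Notation gp := (gromov_product R S).
Hypothesis delta_ge0 : 0 <= delta.
Hypothesis four_point :
  forall w x y z, Num.min (gp w x y) (gp w y z) <= gp w x z + delta.
Implicit Types (w x y z g : G).

Lemma four_point_or w x y z :
  gp w x y <= gp w x z + delta \/ gp w y z <= gp w x z + delta.
Proof. by have := four_point w x y z; rewrite ge_min => /orP. Qed.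

Lemma dist_to_geodesic_le x y z s : geodesics S x y s ->
  (dist_to R S z s <= (gp z x y + (2 * delta + 2))%:E)%E.
Proof.
move=> [sz s0 sd sij]; set d := word_dist S x y in sz sd sij *.
have pE : gp x y z = (d%:R + len (x^-1 * z)%g - len (y^-1 * z)%g) / 2.
  by rewrite /gromov_product /word_dist.
have p_ge0 : 0 <= gp x y z by exact: gp_ge0.
have ple : gp x y z <= d%:R.
  by rewrite gpC // gpE; exact: gp_le_len.
(* The vertex [v] at distance [i] from x approximates the centre of the comparison tripod of x, y,
   z; rounding costs less than 1. As (x, y)_v = 0, the four-point condition at [v] makes (x, z)_v or
   (z, y)_v at most [delta]. *)
pose i := Num.truncn (gp x y z).
have [ile ige] : i%:R <= gp x y z /\ gp x y z < i.+1%:R.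
  by have /andP[] := Num.Theory.truncn_itv p_ge0.
have id_ : (i <= d)%N by rewrite -(ler_nat R); exact: le_trans ple.
pose v := nth 1%g s i.
have xv : word_dist S x v = i by rewrite -s0 sij // subn0.
have vy : word_dist S v y = (d - i)%N by rewrite -sd sij // id_ leqnn.
have vs : [set` s] v by apply: mem_nth; rewrite sz ltnS.
apply: (@le_trans _ _ ((word_dist S z v)%:R)%:E).
  by apply: ereal_inf_lbound; exists v.
rewrite lee_fin.
have vyR : (word_dist S v y)%:R = d%:R - i%:R :> R by rewrite vy natrB.
have xvR : (word_dist S x v)%:R = i%:R :> R by rewrite xv.
have sy a b : (word_dist S a b)%:R = (word_dist S b a)%:R :> R.
  by rewrite /word_dist lenVM.
move: pE ile ige; rewrite -natr1 /gromov_product => pE ile ige.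
have := four_point_or v x z y; rewrite /gromov_product.
rewrite ?(sy v x) ?(sy v z) ?(sy y z) ?(sy x z) ?(sy z x) ?(sy z y) xvR vyR.
rewrite -/d in pE *; rewrite ?(sy y z) ?(sy x z) in pE ile ige.
rewrite -/d in ile ige; rewrite ?(sy z x) ?(sy z y) in pE ile ige *.
lra.
Qed.

Lemma geodesic_deviation_le x y z :
  (geodesic_deviation R S z x y <= (gp z x y + (2 * delta + 2))%:E)%E.
Proof.
by apply: ge_ereal_sup => _ [s xys <-]; exact: dist_to_geodesic_le.
Qed.

End hyperbolic_geometry.

(** * Schottky families *)

Lemma linear_lt_exp2 (a b : nat) : exists n, (a * n + b < 2 ^ n)%N.
Proof.
pose k := (2 * a + b)%N; exists (k + k)%N; rewrite expnD.
have kk : (k < 2 ^ k)%N by exact: ltn_expl.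
have : (k * k.+1 < 2 ^ k * 2 ^ k)%N.
  by move: (2 ^ k)%N kk => m; nia.
by apply: leq_ltn_trans; rewrite /k; nia.
Qed.

Definition positive_word {G : groupType} (u v : G) (p : seq bool) : G :=
  (\prod_(b <- p) (if b then u else v))%g.

(** * Fans of positive words *)

Section fans.
Context {R : realType} {G : groupType} {S : seq G}.
Hypothesis genS : generates S.
Variable delta : R.
Local Notation len g := ((word_length S g)%:R : R).
Local Notation gp := (gromov_product R S).
Hypothesis delta_ge0 : 0 <= delta.
Hypothesis four_point :
  forall w x y z, Num.min (gp w x y) (gp w y z) <= gp w x z + delta.
Implicit Types (f p q w x y z g : G).

(* Far along [1, x] the segments [1, x] and f [1, x] fellow travel; hence if
   f x and y have a large Gromov product, then f p is close to [1, y]. *)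
Lemma translate_near_prefix (r : nat) f p x y q :
    delta < r%:R -> len f <= r%:R -> len p = 5 * r%:R ->
    len (p^-1 * x)%g = len x - 5 * r%:R -> 10 * r%:R <= gp 1%g (f * x)%g y ->
    len q = len (f * p)%g -> len (q^-1 * y)%g = len y - len q ->
  len (q^-1 * (f * p))%g <= 6 * delta.
Proof.
move=> rd fr pr px fxy qfp qy.
have [d0 r0] : 0 <= delta /\ 0 <= r%:R :> R by [].
have fp1 : len (f * p)%g <= 6 * r%:R by have := lenM (R := R) genS f p; lra.
have fp2 : 4 * r%:R <= len (f * p)%g.
  by have := lenB (R := R) genS p (f^-1)%g; rewrite -invgM !lenV //; lra.
have E1 : gp 1%g (f * p)%g (f * x)%g = len (f * p)%g - gp (f * p)%g 1%g (f * x)%g.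
  by rewrite (gpE (f * p)%g) mulg1 gp_len_split // mulVKg; lra.
(* f p lies on a geodesic from f to f x, so (f, f x)_{f p} = 0. The alternative that (f, 1)_{f p} is
   at most [delta] fails, since p has length 5 r and f at most r. *)
have b1 : gp (f * p)%g 1%g (f * x)%g <= delta.
  have z0 : gp (f * p)%g f (f * x)%g = 0.
    rewrite -{2}[f]mulg1 gp_translate (gpE p) mulg1 gp_len_split // mulVKg gp1E pr px.
    lra.
  have [h|h] := four_point_or four_point (f * p)%g f 1%g (f * x)%g; last by lra.
  have : gp (f * p)%g f 1%g = (len p + len (f * p)%g - len f) / 2.
    rewrite /gromov_product /word_dist invgM mulgVK !mulg1 -invgM !lenV //.
  by move: h; rewrite z0; lra.
have qy' : gp 1%g y q = len q.
  by rewrite gp1E lenVM // qy; lra.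
have E3 : gp 1%g (f * p)%g q = (len (f * p)%g + len q - len (q^-1 * (f * p))%g) / 2.
  by rewrite gp1E lenVM.
(* Two uses of the four-point condition along f p, f x, y, q cost [2 * delta]; the third [delta]
   comes from [b1]. *)
have gq : len q - 3 * delta <= gp 1%g (f * p)%g q.
  have [h|h] := four_point_or four_point 1%g (f * p)%g (f * x)%g q; first by lra.
  by have [k|k] := four_point_or four_point 1%g (f * x)%g y q; lra.
by lra.
Qed.

Section positive_words.
Variables u v : G.
Hypothesis positive_word_inj : injective (positive_word u v).

Lemma len_positive_word c (p : seq bool) : (word_length S u <= c)%N ->
  (word_length S v <= c)%N -> (word_length S (positive_word u v p) <= c * size p)%N.
Proof.
move=> uc vc; elim: p => [|b p IH]; first by rewrite /positive_word big_nil word_length1.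
rewrite /positive_word big_cons mulnS; apply: leq_trans (word_lengthM genS _ _) _.
by apply: leq_add IH; case: b.
Qed.

(* If every f x were close to one of the y's, the 2^n translates f p of one
   point p would all lie in a union of linearly many (in n) bounded balls. *)
Lemma positive_word_escape (M : nat) : exists n (T : R), forall x (ys : seq G),
  (size ys <= M)%N -> exists2 p : seq bool, size p = n &
    forall y, y \in ys -> gp 1%g (positive_word u v p * x)%g y < T.
Proof.
pose c := maxn (word_length S u) (word_length S v).
have [B HB] := ball_finite genS (Num.truncn (6 * delta)).
pose r0 := (Num.truncn delta).+1.
(* The list [L] below has at most M * size B * (6 * r + 1) elements, which is linear in n because r
   = c * n + r0. *)
have [n Hn] := linear_lt_exp2 (M * size B * 6 * c) (M * size B * (6 * r0 + 1)).
pose r := (c * n + r0)%N; exists n, (10 * r%:R) => x ys sys.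
have rd : delta < r%:R.
  apply: (lt_le_trans (Num.Theory.truncnS_gt delta)).
  by rewrite ler_nat leq_addl.
apply: contrapT => nop.
have H (p : n.-tuple bool) : exists2 y, y \in ys &
    10 * r%:R <= gp 1%g (positive_word u v p * x)%g y.
  apply: contrapT => noy; apply: nop; exists p; first exact: size_tuple.
  by move=> y yys; rewrite ltNge; apply/negP => ge; apply: noy; exists y.
have lenp (p : n.-tuple bool) : (word_length S (positive_word u v p) <= r)%N.
  rewrite /r (leq_trans (@len_positive_word c p _ _)) ?leq_maxl ?leq_maxr //.
  by rewrite size_tuple leq_addr.
have lenx : (5 * r <= word_length S x)%N.
  have [y _ yge] := H [tuple of nseq n true].
  have := lenp [tuple of nseq n true]; rewrite -(ler_nat R) => lp.
  have := lenM (R := R) genS (positive_word u v [tuple of nseq n true]) x.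
  rewrite gpC // in yge; have := le_trans yge (gp_le_len genS _ _).
  rewrite -(ler_nat R) natrM; have : 0 <= r%:R :> R by exact: ler0n.
  by lra.
have [p0 [lp0 lp0x]] := word_length_prefix genS lenx.
have /choice [pre preP] : forall yt : G * nat, exists q,
    (yt.2 <= word_length S yt.1)%N -> word_length S q = yt.2 /\
      word_length S (q^-1 * yt.1)%g = (word_length S yt.1 - yt.2)%N.
  move=> [y t] /=; have [ty|_] := boolP (t <= word_length S y)%N; last by exists 1%g.
  by have [q qP] := word_length_prefix genS ty; exists q.
(* Balls of radius [6 * delta] around the points [pre (y, t)], each on some geodesic from 1 to y at
   distance t <= 6 r from 1. *)
pose L := flatten [seq [seq (pre (y, t) * b)%g | t <- iota 0 (6 * r + 1), b <- B] | y <- ys].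
pose L' := [seq (positive_word u v p * p0)%g | p : n.-tuple bool <- enum {: n.-tuple bool}].
have uL' : uniq L'.
  rewrite map_inj_uniq ?enum_uniq // => p q /mulIg /positive_word_inj.
  exact: val_inj.
have sub : {subset L' <= L}.
  move=> _ /mapP[p _ ->]; have [y yys yge] := H p.
  pose f := positive_word u v p; have lf := lenp p; rewrite -/f in lf yge *.
  have lfp : (word_length S (f * p0)%g <= 6 * r)%N.
    by rewrite (leq_trans (word_lengthM genS _ _)) // lp0; lia.
  have lfy : (word_length S (f * p0)%g <= word_length S y)%N.
    rewrite (leq_trans lfp) // -(ler_nat R) natrM.
    have := le_trans yge (gp_le_len genS _ _).
    by have : 0 <= r%:R :> R by []; lra.
  have [lq lqy] := preP (y, word_length S (f * p0)%g) lfy; rewrite /= in lq lqy.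
  set q := pre _ in lq lqy.
  apply/flatten_mapP; exists y => //.
  apply/allpairsP; exists (word_length S (f * p0)%g, (q^-1 * (f * p0))%g).
  split; rewrite /= ?mulVKg //; first by rewrite mem_iota add0n addn1 ltnS.
  apply: HB; rewrite Num.Theory.truncn_ge_nat ?mulr_ge0 //.
  apply: (@translate_near_prefix r f p0 x y) => //; rewrite ?lq ?ler_nat //.
  - by rewrite lp0 natrM.
  - by rewrite lp0x natrB // natrM.
  - by rewrite lqy natrB.
have := uniq_leq_size uL' sub.
rewrite size_map -cardE card_tuple card_bool leqNgt => /negP; apply.
apply: leq_ltn_trans Hn.
rewrite size_flatten /shape -map_comp.
rewrite (eq_map (g := fun=> ((6 * r + 1) * size B)%N)); last first.
  by move=> y /=; rewrite size_allpairs size_iota.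
have -> : sumn [seq ((6 * r + 1) * size B)%N | _ <- ys] = (size ys * ((6 * r + 1) * size B))%N.
  by elim: (ys) => //= y l ->; rewrite mulSn.
rewrite (leq_trans (leq_mul sys (leqnn _))) // /r; nia.
Qed.

(** Greedy choice: each new word escapes from the images of x under the earlier ones. [n] and [T]
    come before x, so x may later be taken as far away as these bounds require. *)
Lemma positive_word_fan (N : nat) : exists n (T : R), forall x,
  exists F : nat -> seq bool, (forall i, (i < N)%N -> size (F i) = n) /\
    forall i j, (i < j < N)%N ->
      gp 1%g (positive_word u v (F i) * x)%g (positive_word u v (F j) * x)%g < T.
Proof.
have [n [T HT]] := positive_word_escape N; exists n, T => x.
suff: forall k, (k <= N)%N -> exists F : nat -> seq bool,
    (forall i, (i < k)%N -> size (F i) = n) /\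
    forall i j, (i < j < k)%N ->
      gp 1%g (positive_word u v (F i) * x)%g (positive_word u v (F j) * x)%g < T.
  by move/(_ N (leqnn N)).
elim=> [|k IH] kN; first by exists (fun=> [::]); split => // i j; rewrite ltn0 andbF.
have [F [F1 F2]] := IH (ltnW kN).
have [|p pn Hp] := HT x [seq (positive_word u v (F i) * x)%g | i <- iota 0 k].
  by rewrite size_map size_iota ltnW.
exists (fun i => if i == k then p else F i); split => [i ik|i j /andP[ij jk]].
  by case: eqP => // /eqP ik'; apply: F1; lia.
rewrite (_ : i == k = false); last by lia.
case: eqP => [_|/eqP jk']; last by apply: F2; lia.
by rewrite gpC //; apply: Hp; apply: map_f; rewrite mem_iota; lia.
Qed.

End positive_words.
End fans.

(** * Positive words in free generators *)

Section free_semigroup.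
Context {G : groupType}.
Implicit Types (g h : G) (p q : seq bool).

(** Once common prefixes are cancelled the first letters differ, and the inverse of one word
    followed by the other is reduced and nonempty. *)
Lemma freely_generate_positive_inj g h :
  freely_generate g h -> injective (positive_word g h).
Proof.
move=> fgh.
have eval p b : (\prod_(a <- [seq (c, b) | c <- p]) letter_eval g h a)%g =
    (\prod_(c <- p) (if b then if c then g else h else (if c then g else h)^-1))%g.
  by rewrite big_map; apply: eq_bigr => -[] _; rewrite /letter_eval /=; case: b.
have redT c p : reduced [seq (c', true) | c' <- c :: p].
  by rewrite /reduced; elim: p c => //= c' p IH c; rewrite IH xpair_eqE andbF.
have redF p c l : reduced ((c, false) :: l) ->
    reduced (catrev [seq (c', false) | c' <- p] ((c, false) :: l)).
  by elim: p c l => //= c' p IH c l cl; apply: IH; move: cl; rewrite /reduced /= xpair_eqE andbF.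
have neq1 c p : positive_word g h (c :: p) <> 1%g.
  by have := fgh _ (redT c p); rewrite eval; apply.
have invE p : ((positive_word g h p)^-1 =
    \prod_(a <- rev [seq (c, false) | c <- p]) letter_eval g h a)%g.
  elim: p => [|c p IH]; first by rewrite /positive_word !big_nil invg1.
  rewrite /= rev_cons -cats1 big_cat big_seq1 -IH /positive_word big_cons invgM.
  by rewrite /letter_eval; case: c.
elim=> [|c p IH] [|c' q] //.
- by rewrite {1}/positive_word big_nil => /esym /neq1.
- by rewrite {2}/positive_word big_nil => /neq1.
have [<-|cc'] := eqVneq c c'.
  by rewrite /positive_word !big_cons => /mulgI /IH ->.
move=> E; exfalso.
apply: (fgh (catrev [seq (b, false) | b <- p] ((c, false) :: [seq (b, true) | b <- c' :: q]))).
- apply: redF; have := redT c' q; rewrite /reduced /= => ->.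
  by rewrite andbT xpair_eqE andbT eq_sym.
- by rewrite catrevE; case: (rev _).
rewrite catrevE big_cat big_cons /= -invE.
have -> : (letter_eval g h (c, false) *
    \prod_(j <- [seq (b, true) | b <- c' :: q]) letter_eval g h j = positive_word g h p)%g.
  have -> : positive_word g h p = ((if c then g else h)^-1 * positive_word g h (c :: p))%g.
    by rewrite /positive_word big_cons mulKg.
  by rewrite eval E /letter_eval; case: (c).
by rewrite mulVg.
Qed.

(** The pair g, h is replaced by gh, hg because these two products are spelled by equally many
    elements of the support; positive words of equal length then take equally many steps of the
    walk. *)
Lemma positive_word_comm g h p :
  positive_word (g * h)%g (h * g)%g p =
  positive_word g h (flatten [seq [:: b; ~~ b] | b <- p]).
Proof.
elim: p => [|b p IH]; first by rewrite /positive_word !big_nil.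
rewrite /positive_word /= 3!big_cons -[X in (_ * X)%g]/(positive_word _ _ p) IH mulgA.
by case: b.
Qed.

Lemma positive_word_comm_inj g h : freely_generate g h ->
  injective (positive_word (g * h)%g (h * g)%g).
Proof.
move=> /freely_generate_positive_inj inj p q; rewrite !positive_word_comm => /inj.
by elim: p q => [|b p IH] [|c q] //= [-> _ /IH ->].
Qed.

Lemma positive_wordV (u v : G) p :
  positive_word (u^-1)%g (v^-1)%g p = ((positive_word u v (rev p))^-1)%g.
Proof.
elim: p => [|b p IH]; first by rewrite /positive_word !big_nil invg1.
rewrite rev_cons -cats1 /positive_word big_cons big_cat invgM big_seq1.
by rewrite -[X in (_ * X)%g]/(positive_word (u^-1)%g (v^-1)%g p) IH; case: b.
Qed.

Lemma semigroup_generated_word (A : set G) g : semigroup_generated A g ->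
  exists2 s : seq G, (forall a, a \in s -> A a) & (\prod_(a <- s) a)%g = g.
Proof.
pose B := [set g | exists2 s : seq G, (forall a, a \in s -> A a) & (\prod_(a <- s) a)%g = g].
have BA : subsemigroup B /\ A `<=` B.
  split=> [x y [s sA <-] [t tA <-]|a Aa].
    exists (s ++ t); last by rewrite big_cat.
    by move=> a; rewrite mem_cat => /orP[/sA|/tA].
  by exists [:: a]; rewrite ?big_seq1 // => b; rewrite inE => /eqP->.
by move/(_ B BA).
Qed.

End free_semigroup.

(** * Schottky families from fans *)

Section schottky_families.
Context {R : realType} {G : groupType} {S : seq G}.
Hypothesis genS : generates S.
Variable delta : R.
Local Notation len g := ((word_length S g)%:R : R).
Local Notation gp := (gromov_product R S).
Hypothesis delta_ge0 : 0 <= delta.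
Hypothesis four_point :
  forall w x y z, Num.min (gp w x y) (gp w y z) <= gp w x z + delta.
Implicit Types (w x y z g : G).

Definition schottky (N : nat) (s : 'I_N -> G) (C0 D : R) : Prop :=
  [/\ forall x y, (#|[pred i | (C0 < gp 1%g x (s i * y)%g)%R]| <= 2)%N,
      forall y, (#|[pred i | (C0 < gp 1%g (s i)^-1%g y)%R]| <= 1)%N,
      forall y, (#|[pred i | (len (s i * y)%g < D)%R]| <= 1)%N &
      forall i, D <= len (s i)].

(** Two letters with a large product with the same point would have a large product with each other.
    The clauses on [s i * y] reduce to this: (s_i, s_i y)_1 is the length of s_i minus (s_i^-1,
    y)_1, so s_i y points along s_i unless y undoes s_i. *)
Lemma schottky_of_fan (N : nat) (s : 'I_N -> G) (K : R) :
    0 <= K ->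
    (forall i j, i != j -> gp 1%g (s i) (s j) <= K) ->
    (forall i j, i != j -> gp 1%g (s i)^-1%g (s j)^-1%g <= K) ->
    (forall i, 3 * K + 7 * delta + 2 <= len (s i)) ->
  schottky s (K + 2 * delta) (2 * K + 6 * delta + 1).
Proof.
move=> K0 sK sVK sL; have d0 := delta_ge0.
have le1 x : (#|[pred i | (K + delta < gp 1%g x (s i))%R]| <= 1)%N.
  apply/card_le1_eqP => i j; rewrite !inE => xi xj; apply: contrapT => /eqP ij.
  have := sK i j; rewrite eq_sym => /(_ ij).
  have [h|h] := four_point_or four_point 1%g (s i) x (s j); last by lra.
  by rewrite gpC // in h; lra.
have leV y : (#|[pred i | (K + delta < gp 1%g (s i)^-1%g y)%R]| <= 1)%N.
  apply/card_le1_eqP => i j; rewrite !inE => yi yj; apply: contrapT => /eqP ij.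
  have := sVK i j; rewrite eq_sym => /(_ ij).
  have [h|h] := four_point_or four_point 1%g (s i)^-1%g y (s j)^-1%g; first by lra.
  by rewrite gpC // in h; lra.
have split_ i y : gp 1%g (s i)^-1%g y = len (s i) - gp 1%g (s i) (s i * y)%g.
  exact: gp_len_split.
have cardU_le (A B : pred 'I_N) : (#|[predU A & B]| <= #|A| + #|B|)%N.
  by rewrite -cardUI leq_addr.
split=> [x y|y|y|i]; last by have := sL i; lra.
- apply: (@leq_trans #|[predU [pred i | (K + delta < gp 1%g x (s i))%R]
                          & [pred i | (K + delta < gp 1%g (s i)^-1%g y)%R]]|).
    apply/subset_leq_card/fintype.subsetP => i; rewrite !inE => xsy.
    have [//|xs] := ltP (K + delta) (gp 1%g x (s i)); rewrite /= split_.
    have [h|h] := four_point_or four_point 1%g x (s i * y)%g (s i); first by lra.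
    by rewrite gpC // in h; have := sL i; lra.
  by rewrite (leq_trans (cardU_le _ _)) // (leq_add (le1 x) (leV y)).
- apply: leq_trans (leV y); apply/subset_leq_card/fintype.subsetP => i; rewrite !inE => h.
  by lra.
- apply: leq_trans (leV y); apply/subset_leq_card/fintype.subsetP => i; rewrite !inE split_ => h.
  by have := gp_le_len (R := R) genS (s i) (s i * y)%g; have := sL i; lra.
Qed.

(** The letters are f_i z h_i with a long common middle z. The fan f_i z separates the beginnings, a
    fan of inverses separates the ends, and the lengths of f_i and h_i are bounded independently of
    z. *)
Lemma exists_schottky (N : nat) (u v : G) : injective (positive_word u v) ->
  exists m C0 D (F : 'I_N -> seq bool),
    [/\ 0 <= C0, 2 * C0 + 2 * delta < D, forall i, size (F i) = m,
        schottky (fun i => positive_word u v (F i)) C0 D &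
        schottky (fun i => (positive_word u v (F i))^-1)%g C0 D].
Proof.
move=> inj; have d0 := delta_ge0.
have injV : injective (positive_word (u^-1)%g (v^-1)%g).
  by move=> p q; rewrite !positive_wordV => /invg_inj /inj /(can_inj revK).
have [n1 [T1 H1]] := positive_word_fan genS delta_ge0 four_point inj N.
have [n2 [T2 H2]] := positive_word_fan genS delta_ge0 four_point injV N.
pose c := maxn (word_length S u) (word_length S v).
have lenp p : (word_length S (positive_word u v p) <= c * size p)%N.
  by apply: len_positive_word; rewrite // ?leq_maxl ?leq_maxr.
pose r1 : R := (c * n1)%:R; pose r2 : R := (c * n2)%:R.
have r10 : 0 <= r1 by []. have r20 : 0 <= r2 by [].
(* [2 * r2] pays for dropping the ends h_i in [P1], and [2 * r1] for dropping the f_i in [P2]. *)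
pose K : R := Num.max T1 0 + Num.max T2 0 + 2 * r1 + 2 * r2.
have [T1K T2K T10 T20] : [/\ T1 <= Num.max T1 0, T2 <= Num.max T2 0,
   0 <= Num.max T1 0 & 0 <= Num.max T2 0] by rewrite !le_max !lexx !orbT.
have K0 : 0 <= K by rewrite /K; lra.
pose L := Num.truncn (3 * K + 7 * delta + 2 + r1 + r2).
have [B HB] := ball_finite genS L.
(* There are more positive words of length k than points in the ball. *)
have [b nb] : exists b : seq bool, L%:R < len (positive_word u v b).
  have [k Hk] := linear_lt_exp2 0 (size B).
  apply: contrapT => nob.
  pose W := [seq positive_word u v p | p : k.-tuple bool <- enum {: k.-tuple bool}].
  have uW : uniq W.
    by rewrite map_inj_uniq ?enum_uniq // => p q /inj; exact: val_inj.
  have sub : {subset W <= B}.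
    move=> _ /mapP[p _ ->]; apply: HB; rewrite leqNgt; apply/negP => ge.
    by apply: nob; exists p; rewrite ltr_nat.
  have := uniq_leq_size uW sub.
  by rewrite size_map -cardE card_tuple card_bool leqNgt Hk.
have {}nb : 3 * K + 7 * delta + 2 + r1 + r2 < len (positive_word u v b).
  apply: lt_le_trans (Num.Theory.truncnS_gt _) _.
  by rewrite ler_nat -(ltr_nat R).
pose z := positive_word u v b; rewrite -/z in nb.
have [F [F1 F2]] := H1 z; have [E [E1 E2]] := H2 (z^-1)%g.
pose f i := positive_word u v (F i); pose h i := positive_word u v (rev (E i)).
have pwcat p q : positive_word u v (p ++ q) = (positive_word u v p * positive_word u v q)%g.
  by rewrite /positive_word big_cat.
pose W (i : 'I_N) := F i ++ b ++ rev (E i).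
have WE i : positive_word u v (W i) = (f i * z * h i)%g by rewrite !pwcat mulgA.
have fl (i : 'I_N) : len (f i) <= r1.
  by rewrite ler_nat (leq_trans (lenp _)) // F1.
have hl (i : 'I_N) : len (h i) <= r2.
  by rewrite ler_nat (leq_trans (lenp _)) // size_rev E1.
have half x x' y y' c1 c2 : len (x^-1 * x')%g <= c1 -> len (y^-1 * y')%g <= c2 ->
    gp 1%g x y <= gp 1%g x' y' + c1 + c2.
  move=> xx' yy'; have := gp_perturb (R := R) genS x x' y; have := gp_perturb (R := R) genS y y' x'.
  by rewrite [gp _ y x']gpC // [gp _ y' x']gpC //; lra.
have F2' (i j : 'I_N) : i != j -> gp 1%g (f i * z)%g (f j * z)%g <= T1.
  move=> ij; have [ij'|ij'|/val_inj eq_ij] := ltngtP i j; last by rewrite eq_ij eqxx in ij.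
    by apply/ltW/F2; rewrite ij' ltn_ord.
  by rewrite gpC //; apply/ltW/F2; rewrite ij' ltn_ord.
have E2' (i j : 'I_N) : i != j -> gp 1%g ((h i)^-1 * z^-1)%g ((h j)^-1 * z^-1)%g <= T2.
  rewrite /h -!positive_wordV.
  move=> ij; have [ij'|ij'|/val_inj eq_ij] := ltngtP i j; last by rewrite eq_ij eqxx in ij.
    by apply/ltW/E2; rewrite ij' ltn_ord.
  by rewrite gpC //; apply/ltW/E2; rewrite ij' ltn_ord.
have P1 i j : i != j -> gp 1%g (positive_word u v (W i)) (positive_word u v (W j)) <= K.
  move=> ij; rewrite !WE.
  have := half (f i * z * h i)%g (f i * z)%g (f j * z * h j)%g (f j * z)%g r2 r2.
  have hV k : ((f k * z * h k)^-1 * (f k * z))%g = ((h k)^-1)%g.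
    by rewrite invgM -mulgA mulVg mulg1.
  rewrite !hV !lenV // => /(_ (hl i) (hl j)) => /le_trans; apply.
  by have := F2' _ _ ij; rewrite /K; lra.
have P2 i j : i != j ->
    gp 1%g (positive_word u v (W i))^-1%g (positive_word u v (W j))^-1%g <= K.
  move=> ij; rewrite !WE.
  have := half (f i * z * h i)^-1%g ((h i)^-1 * z^-1)%g (f j * z * h j)^-1%g
               ((h j)^-1 * z^-1)%g r1 r1.
  have hV k : (((f k * z * h k)^-1)^-1 * ((h k)^-1 * z^-1))%g = f k.
    by rewrite invgK -invgM -(mulgA (f k)) mulgK.
  rewrite !hV => /(_ (fl i) (fl j)) => /le_trans; apply.
  by have := E2' _ _ ij; rewrite /K; lra.
have P3 i : 3 * K + 7 * delta + 2 <= len (positive_word u v (W i)).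
  have e1 := lenM (R := R) genS ((f i)^-1)%g (f i * z * h i)%g.
  have e2 := lenM (R := R) genS (z * h i)%g ((h i)^-1)%g.
  rewrite WE; rewrite -mulgA mulKg lenV // in e1; rewrite mulgK lenV // in e2.
  by rewrite -mulgA; have := fl i; have := hl i; lra.
exists (n1 + (size b + n2))%N, (K + 2 * delta), (2 * K + 6 * delta + 1), W.
split.
- lra.
- lra.
- by move=> i; rewrite !size_cat size_rev F1 // E1.
- exact: schottky_of_fan.
- apply: schottky_of_fan => // i; last by rewrite lenV.
  by move=> j; rewrite !invgK; exact: P1.
Qed.

(** All letters are spelled by [r] elements of the support, so that they fit blocks of fixed size.
    The family of inverses serves the walk read backwards. *)
Lemma nonelementary_schottky (N : nat) (A : set G) :
    (0 < N)%N -> nonelementary (semigroup_generated A) ->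
  exists r C0 D (s : 'I_N -> seq G),
    [/\ [/\ (0 < r)%N, 0 <= C0 & 2 * C0 + 2 * delta < D],
        forall i, size (s i) = r,
        forall i a, a \in s i -> A a,
        schottky (fun i => \prod_(a <- s i) a)%g C0 D &
        schottky (fun i => (\prod_(a <- s i) a)^-1)%g C0 D].
Proof.
move=> N0 [g [h [Hg Hh _ _ /positive_word_comm_inj inj]]].
have [sg sgA gE] := semigroup_generated_word Hg.
have [sh shA hE] := semigroup_generated_word Hh.
have [m [C0 [D [F [C00 CD Fm F1 F2]]]]] := exists_schottky N inj.
pose L (p : seq bool) := flatten [seq if b then sg ++ sh else sh ++ sg | b <- p].
have LE p : (\prod_(a <- L p) a)%g = positive_word (g * h)%g (h * g)%g p.
  elim: p => [|b p IH]; first by rewrite /positive_word !big_nil.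
  by rewrite /L /positive_word /= big_cat big_cons IH; case: b; rewrite big_cat gE hE.
have Lsz p : size (L p) = (size p * (size sg + size sh))%N.
  by elim: p => //= b p; rewrite size_cat mulSn => ->; case: b; rewrite size_cat; lia.
have LA p a : a \in L p -> A a.
  elim: p => //= b p IH; rewrite mem_cat => /orP[|/IH//].
  by case: b; rewrite mem_cat => /orP[]; [exact: sgA|exact: shA|exact: shA|exact: sgA].
exists (m * (size sg + size sh))%N, C0, D, (L \o F); split => //.
(* For r = 0 a letter would be the identity, which is shorter than [D]. *)
- split=> //; rewrite lt0n; apply/negP => /eqP r0; have [_ _ _ /(_ (Ordinal N0))] := F1.
  rewrite -LE (size0nil (s := L (F _))); last by rewrite Lsz Fm.
  by rewrite big_nil word_length1; have := delta_ge0; lra.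
- by move=> i; rewrite /= Lsz Fm.
- by move=> i a; exact: LA.
- by under eq_fun do rewrite /= LE.
- by under eq_fun do rewrite /= LE.
Qed.

End schottky_families.

(** * Pivots *)

Section pivots.
Context {R : realType} {G : groupType} {S : seq G}.
Hypothesis genS : generates S.
Variable delta : R.
Local Notation len g := ((word_length S g)%:R : R).
Local Notation gp := (gromov_product R S).
Hypothesis delta_ge0 : 0 <= delta.
Hypothesis four_point :
  forall w x y z, Num.min (gp w x y) (gp w y z) <= gp w x z + delta.
Variables (s : 'I_64 -> G) (C0 D : R).
Hypothesis C0_ge0 : 0 <= C0.
Hypothesis D_large : 2 * C0 + 2 * delta < D.
Hypothesis schottky_s : schottky (S := S) s C0 D.
Implicit Types (u w x y g : G) (ps us ws : seq G) (F : seq G -> G -> R)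
  (E : (seq G -> G -> R) -> R).

Let avg (f : 'I_64 -> R) : R := (\sum_i f i) / 64.

(** A pivot is a recorded point p with (1, x)_p at most [C0 + delta]; the origin plays the role of
    the target. *)
Definition no_pivot ps x : R := (all (fun p => C0 + delta < gp p 1%g x) ps)%:R.

(** Each w is preceded by two letters: the first fills a slot, and the second makes s_j w long
    enough to be a link of a chain, for all j but one. *)
Fixpoint pivot_free_mean ws ps x : R :=
  if ws is w :: ws' then
    avg (fun i => avg (fun j => pivot_free_mean ws' (x :: ps) (x * s i * (s j * w))%g))
  else no_pivot ps x.

Fixpoint local_chain u us : Prop :=
  if us is v :: us' then [/\ gp 1%g u^-1%g v <= C0, D <= len v & local_chain v us']
  else True.

(** Local to global, from the far end: for the product x of the elements after v, (v, v x)_1 is at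
    least D - C0 - delta, hence above C0 + delta, so the four-point condition passes the bound on
    (u^-1, v)_1 to (u^-1, v x)_1. *)
Lemma local_chain_gp u us : local_chain u us ->
  gp 1%g u^-1%g (\prod_(v <- us) v)%g <= C0 + delta.
Proof.
have [d0 c0] := (delta_ge0, C0_ge0).
elim: us u => [|v us IH] u /=; first by rewrite big_nil gpx1 //; lra.
move=> [uv vD /IH vus]; rewrite big_cons; set x := (\prod_(v <- us) v)%g in vus *.
rewrite gp_len_split // in vus; have Dl := D_large.
have [h|h] := four_point_or four_point 1%g u^-1%g (v * x)%g v; first by lra.
by rewrite gpC // in h; lra.
Qed.

Lemma local_chain_rcons u us v : local_chain u us ->
  gp 1%g (last u us)^-1%g v <= C0 -> D <= len v -> local_chain u (rcons us v).
Proof. by elim: us u => //= w us IH u [uw wD /IH h] *; split=> //; exact: h. Qed.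

Let push_ok u v i := (gp 1%g u^-1%g (s i) <= C0) && (gp 1%g (s i)^-1%g v <= C0).

(* [chain l u E]: E is a sub-average of the values of its argument over the
   choices of l Schottky letters in a product x of group elements forming a
   local chain with last element u, together with the list of the points where
   these letters start. The conditions on one letter do not involve the other
   ones, so that the letters remain independent. *)
Inductive chain : nat -> G -> ((seq G -> G -> R) -> R) -> Prop :=
| chain_start x : chain 0 x (fun F => F [::] x)
| chain_slot l u E v : chain l u E -> D <= len v ->
    chain l.+1 v
      (fun F => E (fun ps x => (\sum_(i | push_ok u v i) F (x :: ps) (x * s i * v)%g) / 64))
| chain_extend l u E g : chain l.+1 u E -> gp 1%g u^-1%g g <= C0 -> D <= len g ->
    chain l.+1 g (fun F => E (fun ps x => F ps (x * g)%g)).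

(** The recorded point p itself heads the local chain: as (p^-1, p^-1 x)_1 = (1, x)_p,
    [local_chain_gp] makes p a pivot. *)
Definition chain_support l u ps x : Prop :=
  if l is 0%N then u = x else
  exists p us, [/\ p \in ps, local_chain p us, x = (p * \prod_(v <- us) v)%g & u = last p us].

Lemma chain_le l u E : chain l u E -> forall F F',
  (forall ps x, chain_support l u ps x -> F ps x <= F' ps x) -> E F <= E F'.
Proof.
elim=> {l u E} [x F F' FF'|l u E v _ IH vD F F' FF'|l u E g _ IH ug gD F F' FF'].
- exact: FF'.
- apply: IH => ps x H; rewrite ler_pM2r //; apply: ler_sum => i /andP[ui iv].
  apply: FF'; case: l H => [xu|l [p [us [pps pus xE uE]]]].
    exists x, [:: s i; v]; rewrite mem_head /= -xu; split=> //; last first.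
      by rewrite !big_cons big_nil mulg1 !mulgA.
    by split=> //; case: schottky_s.
  exists p, (rcons (rcons us (s i)) v); rewrite inE pps orbT !last_rcons; split=> //.
    apply: local_chain_rcons; rewrite ?last_rcons //.
    by apply: local_chain_rcons; rewrite -?uE //; case: schottky_s.
  by rewrite -!cats1 !big_cat !big_seq1 /= xE !mulgA.
- apply: IH => ps x [p [us [pps pus xE uE]]]; apply: FF'.
  exists p, (rcons us g); split=> //; rewrite ?last_rcons //.
    by apply: local_chain_rcons; rewrite -?uE.
  by rewrite -cats1 big_cat big_seq1 /= xE mulgA.
Qed.

Lemma chain_scale l u E : chain l u E -> forall c F,
  E (fun ps x => c * F ps x) = c * E F.
Proof.
elim=> {l u E} [//|l u E v _ IH _ c F|l u E g _ IH _ _ c F]; last exact: IH.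
rewrite -IH; congr E; apply/funext => ps; apply/funext => x.
by rewrite mulrA mulr_sumr.
Qed.

Lemma chain_sum l u E : chain l u E -> forall (I : finType) (P : pred I) (F : I -> _),
  E (fun ps x => \sum_(i | P i) F i ps x) = \sum_(i | P i) E (F i).
Proof.
elim=> {l u E} [//|l u E v _ IH _ I P F|l u E g _ IH _ _ I P F]; last exact: IH.
rewrite -IH; congr E; apply/funext => ps; apply/funext => x.
by rewrite exchange_big mulr_suml.
Qed.

Lemma chain_avg l u E : chain l u E -> forall F : 'I_64 -> seq G -> G -> R,
  E (fun ps x => avg (fun i => F i ps x)) = avg (fun i => E (F i)).
Proof.
move=> cE F; rewrite /avg mulrC -(chain_sum cE) -(chain_scale cE).
by congr E; apply/funext => ps; apply/funext => x; rewrite mulrC.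
Qed.

Lemma chain0P u E : chain 0 u E -> E = (fun F => F [::] u).
Proof.
suff: forall l, chain l u E -> l = 0%N -> E = (fun F => F [::] u) by move=> H /H; apply.
by move=> l [].
Qed.

Lemma chain_extendW l u E g : chain l u E -> gp 1%g u^-1%g g <= C0 -> D <= len g ->
  exists v, chain l v (fun F => E (fun ps x => F ps (x * g)%g)).
Proof.
case: l => [/chain0P -> ug gD|l cE ug gD]; first by exists (u * g)%g; exact: chain_start.
by exists g; exact: chain_extend cE ug gD.
Qed.

Lemma pivot_free_mean_ge0 ws ps x : 0 <= pivot_free_mean ws ps x.
Proof.
elim: ws ps x => [|w ws IH] ps x /=; first exact: ler0n.
by rewrite /avg divr_ge0 // sumr_ge0 // => i _; rewrite divr_ge0 // sumr_ge0.
Qed.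

Lemma le_avg f f' : (forall i, f i <= f' i) -> avg f <= avg f'.
Proof. by move=> ff'; rewrite /avg ler_pM2r // ler_sum. Qed.

Lemma pivot_free_mean_sub ws ps ps' x : {subset ps' <= ps} ->
  pivot_free_mean ws ps x <= pivot_free_mean ws ps' x.
Proof.
elim: ws ps ps' x => [|w ws IH] ps ps' x sub /=.
  rewrite ler_nat; case: allP => //= H; case: allP => // H'; exfalso.
  by apply: H' => p /sub /H.
apply: le_avg => i; apply: le_avg => j; apply: IH => p; rewrite !inE.
by case: (p == x) => //=; exact: sub.
Qed.

Lemma sum_le_exceptions (f : 'I_64 -> R) (bad : pred 'I_64) a b k :
    0 <= b -> (#|bad| <= k)%N -> (forall i, bad i -> f i <= a + b) ->
    (forall i, ~~ bad i -> f i <= a) ->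
  \sum_i f i <= 64 * a + k%:R * b.
Proof.
move=> b0 bk fb fa; apply: (@le_trans _ _ (\sum_i (a + (bad i)%:R * b))).
  apply: ler_sum => i _; case: (boolP (bad i)) => [/fb|/fa]; first by rewrite mul1r.
  by rewrite mul0r addr0.
rewrite big_split /= sumr_const card_ord mulr_natl lerD2l -mulr_suml.
rewrite ler_wpM2r // -natr_sum ler_nat (leq_trans _ bk) // -sum1_card [leqRHS]big_mkcond.
by apply: leq_sum => i _; rewrite unfold_in; case: (bad i).
Qed.

(** * Exponential decay of the probability of having no pivot *)

Section chain_decay.
Variables (ws : seq G).
(** A potential: a factor 1/2 for each slot held and 3/4 for each block to come. *)
Let B l : R := 2^-1 ^+ l * (3 / 4) ^+ size ws.
Hypothesis decay : forall l u E, chain l u E -> E (pivot_free_mean ws) <= B l.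

Let B_ge0 l : 0 <= B l. Proof. by rewrite mulr_ge0 ?exprn_ge0. Qed.

(* A broken chain loses its last slot, unless the letter there is exceptional;
   in the latter case the argument is repeated with the previous slot. *)
Lemma broken_chain_decay l u E : chain l u E ->
  forall g, E (fun ps x => pivot_free_mean ws ps (x * g)%g) <= 4 * B l.
Proof.
elim=> {l u E} [x g|l u E v cE IH vD g|l u E g' _ IH _ _ g].
- by have := decay (chain_start (x * g)%g); have := B_ge0 0; lra.
- pose h i := (s i * (v * g))%g.
  apply: (@le_trans _ _ (E (fun ps x => avg (fun i => pivot_free_mean ws ps (x * h i)%g)))).
    apply: (chain_le cE) => ps x _; rewrite ler_pM2r // big_mkcond.
    apply: ler_sum => i _; case: ifP => _; last exact: pivot_free_mean_ge0.
    rewrite /h !mulgA; apply: pivot_free_mean_sub => p pps.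
    by rewrite inE pps orbT.
  rewrite (chain_avg cE) /avg.
  (* Two letters at most align h_i with u^-1, and one at most makes it short. The others extend the
     chain with l slots. The average is at most 73/64 of [B l], below 2 [B l] = 4 [B l.+1]. *)
  pose bad i := ~~ ((gp 1%g u^-1%g (h i) <= C0) && (D <= len (h i))).
  have bad3 : (#|[pred i | bad i]| <= 3)%N.
    have [H1 _ H3 _] := schottky_s.
    rewrite (leq_trans _ (leq_add (H1 u^-1%g (v * g)%g) (H3 (v * g)%g))) //.
    rewrite -cardUI (leq_trans _ (leq_addr _ _)) //.
    apply/subset_leq_card/fintype.subsetP => i; rewrite !inE /bad negb_and -!ltNge.
    by [].
  have : \sum_i E (fun ps x => pivot_free_mean ws ps (x * h i)%g) <= 64 * B l + 3%:R * (3 * B l).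
    apply: (sum_le_exceptions _ bad3) => [|i _|i]; first by have := B_ge0 l; lra.
      by have := IH (h i); lra.
    rewrite inE negbK => /andP[h1 h2].
    by have [v' cv'] := chain_extendW cE h1 h2; exact: decay cv'.
  by rewrite [B l.+1]/B exprS -/(B l) -mulrA -/(B l); have := B_ge0 l; lra.
- have := IH (g' * g)%g; congr (_ <= _); congr E.
  by apply/funext => ps; apply/funext => x; rewrite mulgA.
Qed.

(** Write B for [B l] and fix j first. If s_j w is short, for at most one j, the sum over i is at
    most 64 * 4 B = 256 B. Otherwise the letters i passing [push_ok] form a new slot and contribute
    at most 64 * B / 2 = 32 B, and the three others at most 12 B. This gives 44 B, with excess 212 B
    for the exceptional j; 64 letters suffice for (64 * 44 + 212) / 64^2 < 3/4. *)
Lemma chain_decay_cons w l u E : chain l u E ->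
  E (pivot_free_mean (w :: ws)) <= 3 / 4 * B l.
Proof.
move=> cE /=; rewrite (chain_avg cE).
pose e i j := E (fun ps x => pivot_free_mean ws (x :: ps) (x * s i * (s j * w))%g).
have -> : avg (fun i => E (fun ps x => avg (fun j =>
      pivot_free_mean ws (x :: ps) (x * s i * (s j * w))%g))) =
    (\sum_j \sum_i e i j) / 64 / 64.
  rewrite exchange_big /= mulr_suml; congr (_ / _); apply: eq_bigr => i _.
  exact: (chain_avg cE).
have e_le i j : e i j <= 4 * B l.
  apply: le_trans (broken_chain_decay cE (s i * (s j * w))%g).
  apply: (chain_le cE) => ps x _; rewrite !mulgA; apply: pivot_free_mean_sub => p pps.
  by rewrite inE pps orbT.
have [H1 H2 H3 H4] := schottky_s.
suff : \sum_j \sum_i e i j <= 64 * (44 * B l) + 1%:R * (212 * B l) by have := B_ge0 l; lra.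
apply: (sum_le_exceptions _ (H3 w)) => [|j _|j]; first by have := B_ge0 l; lra.
  apply: (@le_trans _ _ (\sum_(i < 64) 4 * B l)); first exact: ler_sum.
  by rewrite sumr_const card_ord -[_ *+ _]mulr_natl; have := B_ge0 l; lra.
rewrite inE -leNgt => jD.
have slot := decay (chain_slot cE jD).
rewrite [X in X <= _](_ : _ = (\sum_(i | push_ok u (s j * w)%g i) e i j) / 64) in slot;
  last first.
  rewrite mulrC -(chain_sum cE) -(chain_scale cE).
  by congr E; apply/funext => ps; apply/funext => x; rewrite mulrC.
have {}slot : \sum_(i | push_ok u (s j * w)%g i) e i j <= 32 * B l.
  by move: slot; rewrite [B l.+1]/B exprS -mulrA -/(B l); have := B_ge0 l; lra.
rewrite (bigID (push_ok u (s j * w)%g)) /=.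
suff : \sum_(i | ~~ push_ok u (s j * w)%g i) e i j <= 64 * 0 + 3%:R * (4 * B l) by lra.
rewrite big_mkcond; apply: (@sum_le_exceptions _ [pred i | ~~ push_ok u (s j * w)%g i]).
- by have := B_ge0 l; lra.
- rewrite (leq_trans _ (leq_add (H1 u^-1%g 1%g) (H2 (s j * w)%g))) //.
  rewrite -cardUI (leq_trans _ (leq_addr _ _)) //.
  apply/subset_leq_card/fintype.subsetP => i; rewrite !inE mulg1 negb_and -!ltNge.
  by [].
- by move=> i; rewrite inE => ->; rewrite add0r.
- by move=> i; rewrite inE negbK => ->.
Qed.

End chain_decay.

(** When no block is left, a chain holding a slot has a pivot, so [no_pivot] vanishes on its
    support; without slots the bound is 1. *)
Lemma chain_decay ws l u E : chain l u E ->
  E (pivot_free_mean ws) <= 2^-1 ^+ l * (3 / 4) ^+ size ws.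
Proof.
elim: ws l u E => [|w ws IH] l u E cE; last first.
  by have := chain_decay_cons IH w cE; rewrite /= exprS; lra.
case: l cE => [/chain0P -> /=|l cE]; first by rewrite !expr0 mul1r.
apply: (@le_trans _ _ (E (fun _ _ => 0 * 0))).
  apply: (chain_le cE) => ps x [p [us [pps pus xE _]]]; rewrite mul0r /= lern0.
  case: allP => // /(_ _ pps); rewrite gpE mulg1 xE mulKg.
  by have := local_chain_gp pus; rewrite leNgt => /negPf->.
by rewrite (chain_scale cE (0 : R) (fun _ _ => 0)) mul0r mulr_ge0 ?exprn_ge0.
Qed.

(* [None] stands for a block of two Schottky letters, [Some w] for a fixed block. *)
Fixpoint block_mean (bs : seq (option G)) ps x : R :=
  match bs with
  | [::] => no_pivot ps x
  | Some w :: bs' => block_mean bs' (x :: ps) (x * w)%g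
  | None :: bs' => avg (fun i => avg (fun j => block_mean bs' (x :: ps) (x * (s i * s j))%g))
  end.

Fixpoint leading_fixed (bs : seq (option G)) : G :=
  if bs is Some w :: bs' then (w * leading_fixed bs')%g else 1%g.

Fixpoint fixed_gaps (bs : seq (option G)) : seq G :=
  match bs with
  | [::] => [::]
  | Some w :: bs' => fixed_gaps bs'
  | None :: bs' => leading_fixed bs' :: fixed_gaps bs'
  end.

(** Fixed blocks between two random ones merge into one gap; forgetting the points recorded there
    only increases the mean. *)
Lemma block_mean_le_pivot_free_mean bs ps x :
  block_mean bs ps x <= pivot_free_mean (fixed_gaps bs) ps (x * leading_fixed bs)%g.
Proof.
elim: bs ps x => [|[w|] bs IH] ps x /=; first by rewrite mulg1.
  rewrite mulgA; apply: le_trans (IH _ _) _; apply: pivot_free_mean_sub => p pps.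
  by rewrite inE pps orbT.
apply: le_avg => i; apply: le_avg => j; apply: le_trans (IH _ _) _.
by rewrite mulg1 !mulgA.
Qed.

Lemma block_mean_decay bs x : block_mean bs [::] x <= (3 / 4) ^+ count_mem None bs.
Proof.
apply: le_trans (block_mean_le_pivot_free_mean _ _ _) _.
have := chain_decay (fixed_gaps bs) (chain_start (x * leading_fixed bs)%g).
rewrite expr0 mul1r => /le_trans; apply.
suff -> : size (fixed_gaps bs) = count_mem None bs by [].
by elim: bs => [//|[w|] bs IH] /=; rewrite ?IH.
Qed.

(** Finite averages commute, so blocks can be made random one at a time. *)
Lemma block_mean_slot pre rest ps x :
  block_mean (pre ++ None :: rest) ps x =
  avg (fun i => avg (fun j => block_mean (pre ++ Some (s i * s j)%g :: rest) ps x)).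
Proof.
have avg_swap (f : 'I_64 -> 'I_64 -> R) :
    avg (fun i => avg (fun j => f i j)) = avg (fun j => avg (fun i => f i j)).
  rewrite /avg -!mulr_suml exchange_big //.
elim: pre ps x => [|[w|] pre IH] ps x //=.
under eq_fun do under eq_fun do rewrite IH.
under eq_fun do rewrite avg_swap.
rewrite avg_swap; congr avg; apply/funext => i.
under eq_fun do rewrite avg_swap.
by rewrite avg_swap.
Qed.

Lemma block_mean_ge0 bs ps x : 0 <= block_mean bs ps x.
Proof.
elim: bs ps x => [|[w|] bs IH] ps x //=.
by rewrite /avg divr_ge0 // sumr_ge0 // => i _; rewrite divr_ge0 // sumr_ge0.
Qed.

End pivots.

(** * Means over independent letters *)

Section iid_mean.
Context {R : realType} {G : groupType}.
Variable mu : probability (discrete G) R.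
Local Open Scope ereal_scope.
Implicit Types (f g : seq G -> \bar R).

(** An iterated integral, so that induction on the letters replaces a product measure on words. *)
Fixpoint iid_mean n f : \bar R :=
  if n is m.+1 then \int[mu]_x iid_mean m (fun t => f (x :: t)) else f [::].

Lemma iid_mean_ge0 n f : (forall t, 0 <= f t) -> 0 <= iid_mean n f.
Proof.
elim: n f => [|n IH] f f0 //=; apply: integral_ge0 => x _; exact: IH.
Qed.

Lemma le_iid_mean n f g : (forall t, 0 <= f t) ->
  (forall t, size t = n -> f t <= g t) -> iid_mean n f <= iid_mean n g.
Proof.
elim: n f g => [|n IH] f g f0 fg /=; first exact: fg.
apply: ge0_le_integral => //.
  by move=> x _; apply: iid_mean_ge0.
by move=> x _; apply: IH => // t tn; apply: fg; rewrite /= tn.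
Qed.

Lemma eq_iid_mean n f g : (forall t, size t = n -> f t = g t) ->
  iid_mean n f = iid_mean n g.
Proof.
elim: n f g => [|n IH] f g fg /=; first exact: fg.
by apply: eq_integral => x _; apply: IH => t tn; apply: fg; rewrite /= tn.
Qed.

Lemma iid_mean_cst n c : iid_mean n (fun=> c) = c.
Proof.
elim: n => //= n IH; under eq_integral do rewrite IH.
by rewrite integral_cst // [X in _ * X]probability_setT mule1.
Qed.

Lemma iid_mean_sum n (I : Type) (r : seq I) (f : I -> seq G -> \bar R) :
  (forall i t, 0 <= f i t) ->
  iid_mean n (fun t => \sum_(i <- r) f i t) = \sum_(i <- r) iid_mean n (f i).
Proof.
elim: n f => [|n IH] f f0 //=; under eq_integral do rewrite IH //.
rewrite ge0_integral_sum //.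
by move=> i x _; exact: iid_mean_ge0.
Qed.

Lemma iid_meanD n f g : (forall t, 0 <= f t) -> (forall t, 0 <= g t) ->
  iid_mean n (fun t => f t + g t) = iid_mean n f + iid_mean n g.
Proof.
elim: n f g => [|n IH] f g f0 g0 //=; under eq_integral do rewrite IH //.
rewrite ge0_integralD //.
  by move=> x _; exact: iid_mean_ge0.
by move=> x _; exact: iid_mean_ge0.
Qed.

Lemma iid_meanZl n (c : R) f : (0 <= c)%R -> (forall t, 0 <= f t) ->
  iid_mean n (fun t => c%:E * f t) = c%:E * iid_mean n f.
Proof.
move=> c0; elim: n f => [|n IH] f f0 //=; under eq_integral do rewrite IH //.
rewrite ge0_integralZl_EFin //.
by move=> x _; exact: iid_mean_ge0.
Qed.

Lemma iid_mean_cat m n f :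
  iid_mean (m + n) f = iid_mean m (fun t => iid_mean n (fun t' => f (t ++ t'))).
Proof.
by elim: m f => [//|m IH] f /=; apply: eq_integral => x _; rewrite IH.
Qed.

Lemma integral_ge_atom (F : discrete G -> \bar R) (a : G) : (forall x, 0 <= F x) ->
  mu [set a] * F a <= \int[mu]_x F x.
Proof.
move=> F0; have -> : mu [set a] * F a = \int[mu]_(x in [set a]) F x.
  rewrite (eq_integral (cst (F a))) ?integral_cst // 1?muleC //.
  by move=> x; rewrite inE => ->.
exact: ge0_subset_integral.
Qed.

Lemma iid_mean_ge_atom n f t : (forall t, 0 <= f t) -> size t = n ->
  (\prod_(a <- t) mu [set a]) * f t <= iid_mean n f.
Proof.
elim: n f t => [|n IH] f [|a t] f0 //=; first by rewrite big_nil mul1e.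
move=> [tn]; apply: le_trans (@integral_ge_atom
  (fun x => iid_mean n (fun t => f (x :: t))) a _); last first.
  by move=> x; exact: iid_mean_ge0.
rewrite big_cons -muleA lee_wpmul2l //.
exact: (IH (fun t => f (a :: t))).
Qed.

End iid_mean.

(** * Blocks of the walk as Schottky pairs *)

Section pivotal_blocks.
Context {R : realType} {G : groupType} {S : seq G}.
Hypothesis genS : generates S.
Variable delta : R.
Local Notation gp := (gromov_product R S).
Hypothesis delta_ge0 : 0 <= delta.
Hypothesis four_point :
  forall w x y z, Num.min (gp w x y) (gp w y z) <= gp w x z + delta.
Variables (phi : G -> G) (r : nat) (word : 'I_64 -> seq G) (C0 D beta : R).
Let s i := (\prod_(a <- word i) phi a)%g.
Hypothesis C0_ge0 : 0 <= C0.
Hypothesis D_large : 2 * C0 + 2 * delta < D.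
Hypothesis schottky_s : schottky (S := S) s C0 D.
Hypothesis size_word : forall i, size (word i) = r.
Variable mu : probability (discrete G) R.
Hypothesis beta_ge0 : 0 <= beta.
Hypothesis word_mass : forall i, (beta%:E <= \prod_(a <- word i) mu [set a])%E.

Let mean := block_mean (S := S) delta s C0.
Let decay : R := 1 - beta ^+ 2 / 4.

(** [phi] will be the identity for the future of the walk and inversion for its past. A block has
    room for two Schottky words; the last entry is the rest of the walk. *)
Fixpoint walk_blocks (Q : nat) (t : seq G) : seq (option G) :=
  if Q is Q'.+1 then
    Some (\prod_(a <- take (r + r) t) phi a)%g :: walk_blocks Q' (drop (r + r) t)
  else [:: Some (\prod_(a <- t) phi a)%g].

(* The mean over one block is split as B minus the mean of B - h, and the latter
   is at least beta^2 times any value of B - h at a pair of Schottky words. *)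
Lemma block_contraction (h : seq G -> R) (B : R) :
    (forall t, 0 <= h t) -> (forall t, h t <= B) ->
    (\sum_i \sum_j h (word i ++ word j)) / 64 / 64 <= 3 / 4 * B ->
  (iid_mean mu (r + r) (fun t => (h t)%:E) <= (decay * B)%:E)%E.
Proof.
move=> h0 hB hav.
have [b0 B0] : 0 <= beta /\ 0 <= B by split=> //; exact: le_trans (h0 [::]) (hB _).
have k0 t : (0 <= (B - h t)%:E)%E by rewrite lee_fin subr_ge0.
have h0' t : (0 <= (h t)%:E)%E by rewrite lee_fin.
have := iid_meanD mu (r + r) h0' k0.
rewrite (@eq_iid_mean _ _ _ _ _ (fun=> B%:E)); last first.
  by move=> t _; rewrite -EFinD addrC subrK.
rewrite iid_mean_cst.
have kat i j := iid_mean_ge_atom mu k0 (t := word i ++ word j) (n := (r + r)%N).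
have {}kat i j : ((beta ^+ 2 * (B - h (word i ++ word j)))%:E <=
    iid_mean mu (r + r) (fun t => (B - h t)%:E))%E.
  apply: le_trans (kat i j _); last by rewrite size_cat !size_word.
  rewrite EFinM lee_wpmul2r // big_cat /= expr2 EFinM.
  by apply: lee_pmul; rewrite ?lee_fin.
have I0 := iid_mean_ge0 mu (r + r) h0'; have K0 := iid_mean_ge0 mu (r + r) k0.
move: I0 K0 kat; set I := iid_mean _ _ _; set K := iid_mean _ _ _.
case: I => [I| |]; case: K => [K| |] //; rewrite ?lee_fin => I0 K0 kat [BE].
have {}kat i j : beta ^+ 2 * (B - h (word i ++ word j)) <= K.
  by have := kat i j; rewrite lee_fin.
have : \sum_(i < 64) \sum_(j < 64) beta ^+ 2 * (B - h (word i ++ word j)) <=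
    \sum_(i < 64) \sum_(j < 64) K.
  by apply: ler_sum => i _; apply: ler_sum.
under eq_bigr do rewrite -mulr_sumr big_split /= sumrN sumr_const card_ord.
rewrite -mulr_sumr big_split /= sumrN !sumr_const !card_ord.
set H := \sum_i _ in hav *; rewrite -!mulrnA -[B *+ _]mulr_natl -[K *+ _]mulr_natl => le_K.
have bH : beta ^+ 2 * (H / 64 / 64) <= beta ^+ 2 * (3 / 4 * B).
  by rewrite ler_wpM2l ?exprn_ge0.
by rewrite /decay; nra.
Qed.

(** [pre] lists the blocks already treated. With the next block fixed, induction gives the bound B;
    with a random Schottky pair in its place, 3/4 B. These are the hypotheses of
    [block_contraction]. *)
Lemma walk_blocks_decay (Q m : nat) (pre : seq (option G)) (x : G) :
  (iid_mean mu (Q * (r + r) + m)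
     (fun t => (mean (pre ++ walk_blocks Q t) [::] x)%:E)
   <= ((3 / 4) ^+ count_mem None pre * decay ^+ Q)%:E)%E.
Proof.
have mean0 bs : 0 <= mean bs [::] x by exact: block_mean_ge0.
have mean0' bs : (0 <= (mean bs [::] x)%:E)%E by rewrite lee_fin.
elim: Q pre => [|Q IH] pre.
  rewrite expr0 mulr1 -[leRHS](iid_mean_cst mu (0 * (r + r) + m)).
  apply: le_iid_mean => // t _; rewrite lee_fin.
  apply: le_trans (block_mean_decay genS delta_ge0 four_point C0_ge0 D_large schottky_s _ _) _.
  by rewrite count_cat /= !addn0.
rewrite mulSn -addnA iid_mean_cat; set n := (Q * (r + r) + m)%N in IH *.
pose B : R := (3 / 4) ^+ count_mem None pre * decay ^+ Q.
pose H w := iid_mean mu n (fun t => (mean (pre ++ Some w :: walk_blocks Q t) [::] x)%:E).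
have HB w : (H w <= B%:E)%E.
  have := IH (rcons pre (Some w)); rewrite -cats1 count_cat /= !addn0 /H.
  by under eq_iid_mean => t _ do rewrite -catA /=.
have H0 w : (0 <= H w)%E by exact: iid_mean_ge0.
pose h w := fine (H w).
have hE w : (h w)%:E = H w.
  by rewrite /h fineK // ge0_fin_numE // (le_lt_trans (HB w)) ?ltry.
rewrite exprS mulrCA.
rewrite (@eq_iid_mean _ _ _ _ _ (fun t => (h (\prod_(a <- t) phi a)%g)%:E)); last first.
  move=> t tr; rewrite hE; apply: eq_iid_mean => t' _.
  by rewrite /= take_size_cat // drop_size_cat.
apply: block_contraction => [t|t|]; first by rewrite -lee_fin hE.
  by rewrite -lee_fin hE.
have -> : \sum_i \sum_j h (\prod_(a <- word i ++ word j) phi a)%g =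
    \sum_i \sum_j h (s i * s j)%g.
  by apply: eq_bigr => i _; apply: eq_bigr => j _; rewrite big_cat.
have HE : (\sum_i \sum_j h (s i * s j)%g)%:E =
    ((64 * 64)%:E * iid_mean mu n (fun t => (mean (pre ++ None :: walk_blocks Q t) [::] x)%:E))%E.
  rewrite -iid_meanZl // (@eq_iid_mean _ _ _ _ _ (fun t =>
    \sum_i \sum_j (mean (pre ++ Some (s i * s j)%g :: walk_blocks Q t) [::] x)%:E)%E); last first.
    move=> t _; under [RHS]eq_bigr do rewrite sumEFin.
    rewrite sumEFin -EFinM; congr EFin.
    by rewrite /mean block_mean_slot -mulr_suml; field.
  rewrite iid_mean_sum; last by move=> i t; apply: sume_ge0 => j _.
  rewrite -sumEFin; apply: eq_bigr => i _.
  by rewrite iid_mean_sum // -sumEFin; apply: eq_bigr => j _; rewrite hE.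
have := IH (rcons pre None); rewrite -cats1 count_cat /= addn1 exprS -mulrA -/B.
under eq_iid_mean => t _ do rewrite -catA /=.
move=> le_B; have : ((\sum_i \sum_j h (s i * s j)%g)%:E <= (64 * 64)%:E * (3 / 4 * B)%:E)%E.
  by rewrite HE lee_wpmul2l // lee_fin.
by rewrite -EFinM lee_fin; lra.
Qed.

Lemma walk_blocks_mean1 (Q m : nat) (t ps : seq G) (x : G) : size t = (Q * (r + r) + m)%N ->
    (forall p, p \in ps -> C0 + delta < gp p 1%g (x * \prod_(a <- t) phi a)%g) ->
    (forall i, (i <= Q * (r + r))%N -> C0 + delta <
       gp (x * \prod_(a <- take i t) phi a)%g 1%g (x * \prod_(a <- t) phi a)%g) ->
  mean (walk_blocks Q t) ps x = 1.
Proof.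
elim: Q t ps x => [|Q IH] t ps x st psP tP /=.
  rewrite /mean /= /no_pivot (_ : all _ _ = true) //; apply/allP => p.
  rewrite inE => /orP[/eqP->|]; last exact: psP.
  by have := tP 0%N (leq0n _); rewrite take0 big_nil mulg1.
have tE : (x * \prod_(a <- take (r + r) t) phi a * \prod_(a <- drop (r + r) t) phi a =
    x * \prod_(a <- t) phi a)%g.
  by rewrite -mulgA -big_cat cat_take_drop.
rewrite /mean /= -/mean; apply: IH => [|p|i iQ]; rewrite ?tE.
- by rewrite size_drop st mulSn; lia.
- rewrite inE => /orP[/eqP->|]; last exact: psP.
  by have := tP 0%N (leq0n _); rewrite take0 big_nil mulg1.
- have := tP (r + r + i)%N; rewrite mulSn leq_add2l => /(_ iQ).
  by rewrite takeD big_cat mulgA.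
Qed.

(** This keeps geodesics from a to the endpoint farther than [C0 + delta] from the positions 0 to
    L. *)
Definition stays_in_shadow (a : G) (L : nat) : set (seq G) :=
  [set t | forall i, (i <= L)%N -> C0 + delta <
     gp (\prod_(a <- take i t) phi a)%g a (\prod_(a <- t) phi a)%g].

(** Translation by a^-1 brings a to the origin, the target of [no_pivot], and starts the walk at
    a^-1. *)
Lemma stays_in_shadow_decay (a : G) (Q L n : nat) : (Q * (r + r) <= L)%N -> (L <= n)%N ->
  (iid_mean mu n (fun t => (\1_(stays_in_shadow a L) t)%:E) <= (decay ^+ Q)%:E)%E.
Proof.
move=> QL Ln; have [m nE] : exists m, n = (Q * (r + r) + m)%N.
  by exists (n - Q * (r + r))%N; rewrite subnKC // (leq_trans QL).
have := walk_blocks_decay Q m [::] (a^-1)%g; rewrite /= expr0 mul1r -nE.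
apply: le_trans; apply: le_iid_mean => t; first by rewrite lee_fin indicE.
move=> tn; rewrite lee_fin indicE; have [|_] := boolP (t \in _); last exact: block_mean_ge0.
rewrite inE => H; rewrite (@walk_blocks_mean1 Q m) ?tn // => i iQ.
have := H i (leq_trans iQ QL); rewrite -(gp_translate (a^-1)%g) mulVg.
by [].
Qed.

End pivotal_blocks.

(** * The law of the increments *)

Section iid_law.
Context {R : realType} {G : groupType}.
Variable e : nat -> G.
Hypothesis e_surj : forall g, exists n, e n = g.
Context {d : measure_display} {Omega : measurableType d}.
Variables (P : probability Omega R) (mu : probability (discrete G) R).
Variable X : nat -> {mfun Omega >-> discrete G}.
Hypothesis iidX : iid_of_law P mu X.
Local Open Scope ereal_scope.

(* A partition of G into the singletons [set e n] and empty sets, since e may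
   take a value several times. *)
Let atom := seqDU (fun n => [set e n] : set (discrete G)).

Let atom_eq n x : atom n x -> x = e n.
Proof. by rewrite /atom /seqDU => -[]. Qed.

Let bigcup_atom : \bigcup_n atom n = setT.
Proof.
rewrite -seqDU_bigcup_eq -subTset => x _.
by have [n nx] := e_surj x; exists n.
Qed.

Let trivIset_atom : trivIset setT atom. Proof. exact: trivIset_seqDU. Qed.

Lemma integral_atoms (F : discrete G -> \bar R) : (forall x, 0 <= F x) ->
  \int[mu]_x F x = \sum_(n <oo) mu (atom n) * F (e n).
Proof.
move=> F0; rewrite -bigcup_atom ge0_integral_bigcup //.
apply: eq_eseriesr => n _; rewrite (eq_integral (cst (F (e n)))); last first.
  by move=> x; rewrite inE => /atom_eq ->.
by rewrite integral_cst // muleC.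
Qed.

Lemma integral_esum (F : discrete G -> \bar R) : (forall x, 0 <= F x) ->
  \int[mu]_x F x = \esum_(x in [set: G]) (F x * mu [set x]).
Proof.
(* [D] selects one index for each element of G. *)
move=> F0; pose D : set nat := [set n | atom n (e n)].
have atom1 n : D n -> atom n = [set e n].
  by move=> Dn; apply/seteqP; split => x; [exact: atom_eq|move=> ->].
rewrite (@reindex_esum R _ _ D setT e); last first.
  split=> [//|m n|x _].
    rewrite !inE => Dm Dn mn; apply: contrapT => /eqP neq_mn.
    have /trivIsetP/(_ m n I I neq_mn)/seteqP[+ _] := trivIset_atom.
    by move/(_ (e m)); apply; split=> //; rewrite mn.
  have : (\bigcup_n atom n) x by rewrite bigcup_atom.
  by move=> [n _ nx]; have xn := atom_eq nx; exists n; rewrite // /D /= -xn.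
rewrite integral_atoms // nneseries_esumT; last by move=> n; rewrite mule_ge0.
rewrite [RHS]esum_mkcond; apply: eq_esum => n _; rewrite muleC.
have [Dn|Dn] := boolP (n \in D); first by rewrite atom1 //; rewrite inE in Dn.
suff -> : atom n = set0 by rewrite measure0 mule0.
rewrite -subset0 => x nx; have xn := atom_eq nx.
by move: Dn; rewrite notin_setE; apply; rewrite /D /= -xn.
Qed.

Definition sampled (l : seq nat) (A : set (seq G)) : set Omega :=
  [set omega | A [seq (X i omega : G) | i <- l]].

Lemma measurable_preimage_X i (A : set (discrete G)) : measurable (X i @^-1` A).
Proof. by rewrite -[X in measurable X]setTI; exact: measurable_funPT. Qed.

Lemma sampled_consE i l A : sampled (i :: l) A =
  \bigcup_n (X i @^-1` atom n `&` sampled l [set t | A (e n :: t)]).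
Proof.
apply/seteqP; split => omega /=.
  move=> HA; have : (\bigcup_n atom n) (X i omega) by rewrite bigcup_atom.
  by move=> [n _ an]; exists n => //; split => //=; rewrite -(atom_eq an).
by move=> [n _ [/= an]]; rewrite /sampled /= (atom_eq an).
Qed.

Lemma measurable_sampled l A : measurable (sampled l A).
Proof.
elim: l A => [|i l IH] A.
  rewrite /sampled /=; have [HA|HA] := pselect (A [::]).
    by rewrite (_ : [set _ | _] = setT) //; apply/seteqP; split.
  by rewrite (_ : [set _ | _] = set0) //; apply/seteqP; split.
rewrite sampled_consE; apply: bigcup_measurable => n _.
by apply: measurableI; [exact: measurable_preimage_X|exact: IH].
Qed.

Lemma measurable_fun_sampled (d' : measure_display) (T : sigmaRingType d')
  (l : seq nat) (F : seq G -> T) :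
  measurable_fun setT (fun omega => F [seq (X i omega : G) | i <- l]).
Proof.
by move=> _ Y _; rewrite setTI; exact: (measurable_sampled l (F @^-1` Y)).
Qed.

Lemma independent_seq (l : seq nat) (B : nat -> set (discrete G)) : uniq l ->
  P (\bigcap_(j in [set` l]) X j @^-1` B j) = \prod_(j <- l) mu (B j).
Proof.
move=> ul; have [indep law] := iidX.
have := indep [fset j in l]%fset B (fun=> I).
rewrite (_ : [set` [fset j in l]%fset] = [set` l]); last first.
  by apply/seteqP; split => j /=; rewrite !inE.
move=> ->; rewrite (perm_big l) /=.
  by apply: eq_bigr => j _; exact: law.
by apply: uniq_perm => [||j]; rewrite ?fset_uniq ?inE.
Qed.

(** The indices of [l] move to [l'] one by one, each time splitting along the atoms; once [l] is
    empty, only the independence of events on single increments remains. *)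
Lemma cylinder_law (l' l : seq nat) (B : nat -> set (discrete G)) (A : set (seq G)) :
    uniq (l' ++ l) ->
  P ((\bigcap_(j in [set` l']) X j @^-1` B j) `&` sampled l A) =
  (\prod_(j <- l') mu (B j)) * iid_mean mu (size l) (fun t => (\1_A t)%:E).
Proof.
elim: l l' B A => [|i l IH] l' B A.
  rewrite cats0 => ul; rewrite /= indicE; have [HA|HA] := pselect (A [::]).
    have -> : sampled [::] A = setT by apply/seteqP; split.
    by rewrite mem_set // mule1 setIT independent_seq.
  have -> : sampled [::] A = set0 by apply/seteqP; split.
  by rewrite memNset // mule0 setI0 measure0.
move=> ul; rewrite sampled_consE setI_bigcupr measure_bigcup /=; last 2 first.
- move=> n _; apply: measurableI; last first.
    by apply: measurableI; [exact: measurable_preimage_X|exact: measurable_sampled].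
  rewrite bigcap_seq; apply: bigsetI_measurable => j _; exact: measurable_preimage_X.
- apply/trivIsetP => m n _ _ mn; apply/seteqP; split => // omega [[_ [/= am _]] [_ [/= an _]]].
  have /trivIsetP/(_ m n I I mn) := trivIset_atom.
  by move/seteqP => [/(_ (X i omega)) + _]; apply.
rewrite integral_atoms; last by move=> x; apply: iid_mean_ge0 => t; rewrite lee_fin indicE.
have cfin : \prod_(j <- l') mu (B j) \is a fin_num.
  by apply: prode_fin_num => j _; exact: fin_num_measure.
rewrite -(fineK cfin).
rewrite -nneseriesZl; last first.
  by move=> n _; rewrite mule_ge0 //; apply: iid_mean_ge0 => t; rewrite lee_fin indicE.
rewrite (eq_eseriesl (Q := xpredT)); last by move=> n; rewrite in_setT.
apply: eq_eseriesr => n _; rewrite fineK //.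
have il' : i \notin l' by move: ul; rewrite uniq_catC /= mem_cat negb_or => /andP[/andP[]].
pose B' j := if j == i then atom n else B j.
have -> : (\bigcap_(j in [set` l']) X j @^-1` B j) `&`
      (X i @^-1` atom n `&` sampled l [set t | A (e n :: t)]) =
    (\bigcap_(j in [set` i :: l']) X j @^-1` B' j) `&` sampled l [set t | A (e n :: t)].
  rewrite setIA; congr (_ `&` _); apply/seteqP; split => omega.
    move=> [H1 H2] j /=; rewrite inE /B' => /orP[/eqP->|jl]; first by rewrite eqxx.
    by case: eqP => [->|_]; [exact: H2|exact: H1].
  move=> H; split; last by have := H i (mem_head _ _); rewrite /B' eqxx.
  move=> j /= jl; have := H j; rewrite /= inE jl orbT /B' => /(_ isT).
  by case: eqP jl il' => [->|//] ->.
rewrite IH; last by rewrite -cat1s -catA uniq_catCA catA cats1 cat_rcons.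
rewrite big_cons {1}/B' eqxx [RHS]muleCA [RHS]muleA; congr (_ * _ * _).
apply: eq_big_seq => j jl; rewrite /B'; case: eqP jl il' => [->|//] ->.
by [].
Qed.

Lemma sampled_law (l : seq nat) (A : set (seq G)) : uniq l ->
  P (sampled l A) = iid_mean mu (size l) (fun t => (\1_A t)%:E).
Proof.
move=> ul; have := @cylinder_law [::] l (fun=> setT) A ul.
rewrite big_nil mul1e => <-; congr (P _).
by apply/seteqP; split => omega // -[].
Qed.

End iid_law.

(** * The deviation inequality *)

Section neighborhoods.
Context {R : realType} {G : groupType}.
Implicit Types mu : probability (discrete G) R.

(** Radius 1 bounds the ratio of mu0 to mu by 2. *)
Lemma neighborhood_mass mu mu0 a : neighborhood mu0 1 mu -> msupport mu0 a ->
  ((fine (mu0 [set a]) / 2)%:E <= mu [set a])%E.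
Proof.
rewrite /neighborhood /= /discrepancy; case: ifP => [/asboolP supE|_ //] le1 sa.
have sa' : msupport mu a by rewrite supE.
have mf (nu : probability (discrete G) R) : nu [set a] \is a fin_num.
  exact: fin_num_measure.
have ge0 (nu : probability (discrete G) R) : 0 <= fine (nu [set a]) by exact: fine_ge0.
have m_gt0 : 0 < fine (mu [set a]).
  by rewrite lt_neqAle ge0 andbT eq_sym fine_eq0.
have le2 : ((Num.max (mass_ratio mu mu0 a) (mass_ratio mu0 mu a))%:E <= 2%:E)%E.
  apply: (@le_trans _ _ (ereal_sup [set
     (Num.max (mass_ratio mu mu0 b) (mass_ratio mu0 mu b))%:E | b in msupport mu0])).
    by apply: ereal_sup_ubound; exists a.
  by move: le1; rewrite leeBlDr // -EFinD.
move: le2; rewrite lee_fin ge_max => /andP[_]; rewrite /mass_ratio ler_pdivrMr // => le2.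
by rewrite -(fineK (mf mu)) lee_fin; lra.
Qed.

Lemma neighborhood_word_mass mu0 (N : nat) (w : 'I_N -> seq G) :
    (forall i a, a \in w i -> msupport mu0 a) ->
  exists beta : R, [/\ 0 < beta, beta <= 1 & forall mu, neighborhood mu0 1 mu ->
    forall i, (beta%:E <= \prod_(a <- w i) mu [set a])%E].
Proof.
move=> wsupp; pose b i := \prod_(a <- w i) (fine (mu0 [set a]) / 2).
have b_gt0 i : 0 < b i.
  rewrite /b big_seq; apply: prodr_gt0 => a /wsupp sa.
  rewrite divr_gt0 // lt_neqAle fine_ge0 // andbT eq_sym fine_eq0 //.
  exact: fin_num_measure.
exists (\big[Num.min/1]_i b i); split.
- by apply/bigmin_gtP; split=> // i _.
- exact: bigmin_le_id.
- move=> mu mumu0 i; apply: (@le_trans _ _ (b i)%:E); first by rewrite lee_fin bigmin_le_cond.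
  rewrite /b; move: (wsupp i); elim: (w i) => [|a l IH] ls; first by rewrite !big_nil.
  rewrite !big_cons EFinM; apply: lee_pmul.
  + by rewrite lee_fin divr_ge0 // fine_ge0.
  + by rewrite lee_fin prodr_ge0 // => c _; rewrite divr_ge0 // fine_ge0.
  + by apply: neighborhood_mass => //; apply: ls; rewrite mem_head.
  + by apply: IH => c cl; apply: ls; rewrite inE cl orbT.
Qed.

End neighborhoods.

(** Rounding loses one factor 1 - eta, at least 1/2, whence the 2; then (Q + 1) r >= M and 1 - eta
    <= exp(-eta). *)
Lemma powB1_le_expR {R : realType} (eta M : R) (r : nat) :
    0 <= eta -> eta <= 2^-1 -> (0 < r)%N -> 0 <= M ->
  (1 - eta) ^+ (Num.truncn M %/ r) <= 2 * expR (- (eta * (M / r%:R))).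
Proof.
move=> eta0 eta1 r0 M0; set Q := (_ %/ _)%N.
have MQ : M / r%:R <= Q.+1%:R.
  rewrite ler_pdivrMr ?ltr0n // -natrM.
  apply: (le_trans (ltW (Num.Theory.truncnS_gt M))); rewrite ler_nat.
  exact: ltn_ceil.
have : (1 - eta) ^+ Q.+1 <= expR (- (eta * (M / r%:R))).
  apply: (@le_trans _ _ (expR (- eta) ^+ Q.+1)).
    by rewrite lerXn2r ?nnegrE ?expR_ge0 ?expR_ge1Dx //; lra.
  by rewrite -expRM_natl ler_expR mulrN lerN2 [leRHS]mulrC ler_wpM2l.
have eta1' : 0 <= 1 - eta by lra.
by rewrite exprS; have := exprn_ge0 Q eta1'; nra.
Qed.

Section sampled_events.
Context {R : realType} {G : groupType} {S : seq G}.
Hypothesis genS : generates S.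
Context {d : measure_display} {Omega : measurableType d}.
Variables (P : probability Omega R) (mu : probability (discrete G) R).
Variable X : nat -> {mfun Omega >-> discrete G}.
Hypothesis iidX : iid_of_law P mu X.
Local Notation len g := ((word_length S g)%:R : R).
Local Open Scope ereal_scope.

Lemma le_bigcup_seq (I : choiceType) (l : seq I) (F : I -> set Omega) :
  (forall i, measurable (F i)) -> P (\bigcup_(i in [set` l]) F i) <= \sum_(i <- l) P (F i).
Proof.
move=> mF; rewrite bigcup_seq; elim: l => [|i l IH]; first by rewrite !big_nil measure0.
rewrite !big_cons; apply: le_trans (measureU2 _ _ _) _ => //.
  by apply: bigsetU_measurable.
exact: leeD2l.
Qed.

Definition jump_pair (l1 l2 : seq nat) (c : R) : set Omega :=
  [set omega | (exists2 i, i \in l1 & (c <= len (X i omega))%R) /\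
               (exists2 j, j \in l2 & (c <= len (X j omega))%R)].

Let jumps c : set (discrete G) := [set x | (c <= len x)%R].

Let measurable_jumps c i j : measurable (X i @^-1` jumps c `&` X j @^-1` jumps c).
Proof. by apply: measurableI; exact: measurable_preimage_X. Qed.

Let jump_pairE (l1 l2 : seq nat) (c : R) : jump_pair l1 l2 c =
  \bigcup_(i in [set` l1]) \bigcup_(j in [set` l2]) (X i @^-1` jumps c `&` X j @^-1` jumps c).
Proof.
apply/seteqP; split => omega /=.
  by move=> [[i il ci] [j jl cj]]; exists i => //; exists j.
by move=> [i il [j jl [/= ci cj]]]; split; [exists i|exists j].
Qed.

Lemma measurable_jump_pair l1 l2 c : measurable (jump_pair l1 l2 c).
Proof.
rewrite jump_pairE bigcup_seq; apply: bigsetU_measurable => i _.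
by rewrite bigcup_seq; exact: bigsetU_measurable.
Qed.

Lemma jump_pair_bound (l1 l2 : seq nat) (c : R) : uniq (l1 ++ l2) ->
  P (jump_pair l1 l2 c) <= ((size l1)%:R * (size l2)%:R)%:E *
    P [set omega | (c <= len (X 0%N omega))%R] ^+ 2.
Proof.
move=> ul; pose A := jumps c; rewrite jump_pairE -/A.
have mA i j : measurable (X i @^-1` A `&` X j @^-1` A) by exact: measurable_jumps.
apply: le_trans (le_bigcup_seq _ _) _.
  by move=> i; rewrite bigcup_seq; exact: bigsetU_measurable.
have [_ law] := iidX.
have PA j : P (X j @^-1` A) = mu A by exact: law.
have pair i j : i \in l1 -> j \in l2 -> P (X i @^-1` A `&` X j @^-1` A) = mu A ^+ 2.
  move=> il jl; have ij : uniq [:: i; j].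
    move: ul; rewrite cat_uniq => /and3P[_ /hasPn/(_ j jl) jl1 _].
    rewrite /= inE andbT; apply: contra jl1 => /eqP <-.
    by [].
  have := independent_seq iidX (fun=> A) ij; rewrite !big_cons big_nil mule1 -expe2 => <-.
  congr (P _); apply/seteqP; split=> omega.
    by move=> [Ai Aj] k /=; rewrite !inE => /orP[/eqP->|/eqP->].
  by move=> H; split; apply: H; rewrite /= !inE eqxx ?orbT.
apply: (@le_trans _ _ (\sum_(i <- l1) \sum_(j <- l2) mu A ^+ 2)).
  rewrite big_seq [leRHS]big_seq; apply: lee_sum => i il.
  apply: le_trans (le_bigcup_seq _ _) _ => //.
  by rewrite big_seq [leRHS]big_seq; apply: lee_sum => j jl; rewrite pair.
rewrite (_ : [set omega | _] = X 0%N @^-1` A) // PA.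
rewrite -(fineK (fin_num_measure mu A _)) //.
rewrite -EFin_expe; under eq_bigr do rewrite sumEFin.
rewrite sumEFin -EFinM lee_fin.
rewrite !big_const_seq !count_predT !iter_addr !addr0.
by rewrite -[X in (X <= _)%R]mulr_natl -[(_ *+ size l2)%R]mulr_natl mulrA.
Qed.

End sampled_events.

Section deviation.
Context {R : realType} {G : groupType} {S : seq G}.
Hypothesis genS : generates S.
Variable delta : R.
Local Notation len g := ((word_length S g)%:R : R).
Local Notation gp := (gromov_product R S).
Hypothesis delta_ge0 : 0 <= delta.
Hypothesis four_point :
  forall w x y z, Num.min (gp w x y) (gp w y z) <= gp w x z + delta.

(** Let b be the endpoint. Some early position w has (a, b)_w at most C0 + delta. If the first N
    letters were all shorter than c, w would be within N c of the origin, and changing the base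
    point would contradict the lower bound on (a, b)_1. *)
Lemma jump_of_leaves_shadow (phi : G -> G) (C0 c : R) (a : G) (N : nat) (u : seq G) :
    (forall x, word_length S (phi x) = word_length S x) -> 0 <= c ->
    ~ stays_in_shadow (S := S) delta phi C0 a N u ->
    C0 + delta + N%:R * c < gp 1%g a (\prod_(x <- u) phi x)%g ->
  exists2 x, x \in take N u & c <= len x.
Proof.
move=> lphi c0 leaves far; apply: contrapT => nojump; apply: leaves => i iN.
rewrite ltNge; apply/negP => near.
have : len (\prod_(x <- take i u) phi x)%g <= i%:R * c.
  have : forall x, x \in take i u -> len x <= c.
    move=> x xi; rewrite leNgt; apply/negP => cx; apply: nojump; exists x; last exact: ltW.
    by apply: (@mem_take i); rewrite take_takel.
  have : (size (take i u) <= i)%N by rewrite size_take_min geq_minl.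
  move: (take i u) => l0; elim: l0 (i) => [|x l IH] k lk lc.
    by rewrite big_nil word_length1 mulr_ge0.
  case: k lk => // k lk; rewrite big_cons.
  have := lenM (R := R) genS (phi x) (\prod_(j <- l) phi j)%g; rewrite lphi.
  have := lc _ (mem_head _ _).
  have := IH k lk (fun y yl => lc y (mem_behead (s := x :: l) yl)).
  by rewrite -natr1; lra.
have : i%:R * c <= N%:R * c by rewrite ler_wpM2r // ler_nat.
have := gp_base_le (R := R) genS (\prod_(x <- take i u) phi x)%g a (\prod_(x <- u) phi x)%g.
by lra.
Qed.

Section shadow_probability.
Variables (phi : G -> G) (r : nat) (word : 'I_64 -> seq G) (C0 D beta : R).
Hypothesis C0_ge0 : 0 <= C0.
Hypothesis D_large : 2 * C0 + 2 * delta < D.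
Hypothesis schottky_s : schottky (S := S) (fun i => \prod_(a <- word i) phi a)%g C0 D.
Hypothesis size_word : forall i, size (word i) = r.
Hypothesis beta_ge0 : 0 <= beta.
Hypothesis beta_le1 : beta <= 1.
Context {d : measure_display} {Omega : measurableType d}.
Variables (P : probability Omega R) (mu : probability (discrete G) R).
Variable X : nat -> {mfun Omega >-> discrete G}.
Hypothesis iidX : iid_of_law P mu X.
Hypothesis word_mass : forall i, (beta%:E <= \prod_(a <- word i) mu [set a])%E.

(** The increments in [l1] determine the target and those in [l2] drive the walk, so the target can
    be frozen first. *)
Definition shadow_event (l1 l2 : seq nat) (a : seq G -> G) (N : nat) : set Omega :=
  sampled X (l1 ++ l2) [set t |
    stays_in_shadow (S := S) delta phi C0 (a (take (size l1) t)) N (drop (size l1) t)].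

Lemma shadow_event_prob (l1 l2 : seq nat) (a : seq G -> G) (N : nat) : uniq (l1 ++ l2) ->
  (P (shadow_event l1 l2 a N) <= ((1 - beta ^+ 2 / 4) ^+ (N %/ (r + r)))%:E)%E.
Proof.
have [e e_surj] := generated_enum genS.
move=> ul; rewrite /shadow_event (sampled_law e_surj iidX) // size_cat iid_mean_cat.
have dec0 : 0 <= (1 - beta ^+ 2 / 4).
  by have b0 := beta_ge0; have b1 := beta_le1; nra.
rewrite -[leRHS](iid_mean_cst mu (size l1)); apply: le_iid_mean => [t|t tl1].
  by apply: iid_mean_ge0 => t'; rewrite lee_fin indicE.
rewrite (@eq_iid_mean _ _ _ _ _ (fun t' =>
    (\1_(stays_in_shadow (S := S) delta phi C0 (a t) N) t')%:E)); last first.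
  move=> t' _; rewrite !indicE; congr (_%:R)%:E; congr nat_of_bool.
  by apply/idP/idP; rewrite !inE /= -tl1 take_size_cat // drop_size_cat.
have [Nl2|l2N] := leqP N (size l2).
  by apply: (stays_in_shadow_decay genS delta_ge0 four_point C0_ge0 D_large schottky_s
    size_word beta_ge0 word_mass) => //; exact: leq_trunc_div.
(* A walk with fewer than N letters reaches its endpoint b within the range, where (a, b)_b = 0: the
   event is empty. *)
rewrite (@eq_iid_mean _ _ _ _ _ (fun=> 0%E)); first by rewrite iid_mean_cst lee_fin exprn_ge0.
move=> u ul2; rewrite indicE memNset // => /(_ (size l2) (ltnW l2N)).
rewrite take_oversize ?ul2 // gpxx //.
by have := delta_ge0; have := C0_ge0; lra.
Qed.

End shadow_probability.

End deviation.

(** * Tail of the Gromov product and of the geodesic deviation *)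

Section tail.
Context {R : realType} {G : groupType} {S : seq G}.
Hypothesis genS : generates S.
Variable delta : R.
Local Notation len g := ((word_length S g)%:R : R).
Local Notation gp := (gromov_product R S).
Hypothesis delta_ge0 : 0 <= delta.
Hypothesis four_point :
  forall w x y z, Num.min (gp w x y) (gp w y z) <= gp w x z + delta.
Variable mu0 : probability (discrete G) R.
Hypothesis nonelem : nonelementary (semigroup_generated (msupport mu0)).

Lemma walkE d (Omega : measurableType d) (X : nat -> {mfun Omega >-> discrete G}) n omega :
  walk X n omega = (\prod_(a <- [seq (X i omega : G) | i <- iota 0 n]) a)%g.
Proof. by rewrite big_map -{2}[n]subn0 -/(index_iota 0 n) big_mkord. Qed.

Lemma gromov_product_tail : exists2 C : R, 1 <= C &
  forall mu, neighborhood mu0 1 mu ->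
  forall (d : measure_display) (Omega : measurableType d)
    (P : probability Omega R) (X : nat -> {mfun Omega >-> discrete G}),
    iid_of_law P mu X ->
    forall (t M : R) (k n : nat), 1 <= M -> (k <= n)%N ->
      measurable [set omega | t <= gp (walk X k omega) 1%g (walk X n omega)] /\
      (P [set omega | (t <= gp (walk X k omega) 1%g (walk X n omega))%R]
       <= (C * expR (- M / C))%:E + (M ^+ 2)%:E *
          (P [set omega | ((t - C) / M <= len (X 0%N omega))%R]) ^+ 2)%E.
Proof.
have [r [C0 [D [w [[r0 C00 CD] wr wsupp sch schV]]]]] :=
  nonelementary_schottky genS delta_ge0 four_point (N := 64) isT nonelem.
have [beta [b0 b1 mass]] := neighborhood_word_mass wsupp.
pose eta := beta ^+ 2 / 4; pose q : R := (r + r)%:R.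
have eta0 : 0 < eta by rewrite divr_gt0 ?exprn_gt0.
have eta1 : eta <= 2^-1 by rewrite /eta; nra.
have d0 := delta_ge0.
have q0 : 0 < q by rewrite ltr0n addn_gt0 r0.
have qeta0 : 0 < q / eta by rewrite divr_gt0.
(* [4] is twice the factor 2 of a shadow event, [C0 + delta + 1] gives the margin in [far], and
   [q / eta] the exponential rate. *)
pose C := 4 + (C0 + delta + 1) + q / eta; exists C; first by rewrite /C; lra.
move=> mu mumu0 d Omega P X iidX t M k n M1 kn.
have [e e_surj] := generated_enum genS.
set E := [set omega | t <= _].
have mE' : measurable E.
  have -> : E = sampled X (iota 0 n)
      [set s | t <= gp (\prod_(a <- take k s) a)%g 1%g (\prod_(a <- s) a)%g].
    apply/seteqP; split => omega; rewrite /E /sampled /= !walkE -map_take take_iota;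
      rewrite (minn_idPl kn) => H; exact: H.
  exact: (measurable_sampled e_surj).
split=> //; set T := [set omega | _ <= len _].
have C_gt0 : 0 < C by rewrite /C; lra.
have M0 : 0 < M by lra.
have expC0 : 0 <= C * expR (- M / C) by rewrite mulr_ge0 ?expR_ge0 // ltW.
(* For t <= C the last probability is 1 and M^2 >= 1. *)
have [tC|Ct] := leP t C.
  have -> : T = setT.
    apply/seteqP; split => // omega _; rewrite /T /=.
    apply: le_trans (len_ge0 _); rewrite pmulr_lle0 ?invr_gt0 //; lra.
  rewrite probability_setT expe2 mule1 mule1; apply: le_trans (probability_le1 P mE') _.
  rewrite -EFinD lee_fin; have : 1 <= M ^+ 2 by exact: exprn_ege1.
  lra.
pose N := Num.truncn M; pose c := (t - C) / M.
have c0 : 0 < c by rewrite divr_gt0 // subr_gt0.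
have NM : N%:R <= M by have /andP[] := Num.Theory.truncn_itv (ltW M0).
have Nc : N%:R * c <= t - C.
  by apply: le_trans (ler_wpM2r (ltW c0) NM) _; rewrite /c mulrCA divff ?mulr1 ?gt_eqF.
have far x y : t <= gp 1%g x y -> C0 + delta + N%:R * c < gp 1%g x y.
  by rewrite /C in Nc *; lra.
pose l1 := iota 0 k; pose l2 := iota k (n - k).
have l12 : l1 ++ l2 = iota 0 n by rewrite /l1 /l2 -iotaD subnKC.
have ul : uniq (l1 ++ l2) by rewrite l12 iota_uniq.
have ul' : uniq (l2 ++ rev l1).
  by rewrite uniq_catC (perm_uniq (s2 := l1 ++ l2)) // perm_cat2r perm_rev.
(* Seen from Z_k, [RB] concerns the future walk to b = Z_k^-1 Z_n with target a = Z_k^-1, and [LB]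
   the past, reversed and inverted, walking to a with target b. *)
pose RB := shadow_event (S := S) delta id C0 X l1 l2 (fun s => (\prod_(a <- s) a)^-1)%g N.
pose LB := shadow_event (S := S) delta (fun x => x^-1)%g C0 X l2 (rev l1)
  (fun s => \prod_(a <- s) a)%g N.
pose J := jump_pair (S := S) X (take N (rev l1)) (take N l2) c.
have sub : E `<=` (RB `|` LB) `|` J.
  move=> omega; rewrite /E /=.
  set a := (\prod_(x <- [seq (X i omega : G) | i <- rev l1]) x^-1)%g.
  set b := (\prod_(x <- [seq (X i omega : G) | i <- l2]) x)%g.
  have aE : a = ((\prod_(x <- [seq (X i omega : G) | i <- l1]) x)^-1)%g.
    rewrite /a; elim: (l1) => [|i l IH]; first by rewrite /rev !big_nil invg1.
    by rewrite rev_cons map_rcons -cats1 big_cat big_seq1 IH /= big_cons invgM.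
  have -> : gp (walk X k omega) 1%g (walk X n omega) = gp 1%g a b.
    rewrite gpE mulg1 !walkE -l12 map_cat big_cat /= -/l1 -/b mulKg aE.
    by [].
  move=> tab.
  have [RBo|nRB] := pselect (RB omega); first by left; left.
  have [LBo|nLB] := pselect (LB omega); first by left; right.
  right; split.
    have [x] : exists2 x, x \in take N [seq (X i omega : G) | i <- rev l1] & c <= len x.
      apply: (jump_of_leaves_shadow genS (delta := delta) (C0 := C0)
        (phi := fun x => x^-1%g) (a := b)); rewrite ?(ltW c0) //.
      - by move=> x; rewrite word_lengthV.
      - move=> st; apply: nLB; rewrite /LB /shadow_event /sampled /= map_cat.
        by rewrite take_size_cat ?size_map // drop_size_cat ?size_map.
      - by rewrite gpC //; apply: far.
    by rewrite -map_take => /mapP[i il ->] ci; exists i.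
  have [x] : exists2 x, x \in take N [seq (X i omega : G) | i <- l2] & c <= len x.
    apply: (jump_of_leaves_shadow genS (delta := delta) (C0 := C0)
      (phi := id) (a := a)); rewrite ?(ltW c0) //.
    - move=> st; apply: nRB; rewrite /RB /shadow_event /sampled /= map_cat.
      by rewrite take_size_cat ?size_map // drop_size_cat ?size_map // -aE.
    - exact: far.
  by rewrite -map_take => /mapP[i il ->] ci; exists i.
(* The two jumps have disjoint ranges of indices; independence then gives the square. *)
have uJ : uniq (take N (rev l1) ++ take N l2).
  apply: (subseq_uniq (s2 := rev l1 ++ l2)); last by rewrite uniq_catC.
  by apply: cat_subseq; exact: take_subseq.
have PJ := jump_pair_bound iidX c uJ (S := S); rewrite -/J in PJ.
have rot0 : (0 < r + r)%N by rewrite addn_gt0 r0.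
have PR : (P RB <= (2 * expR (- (eta * (M / q))))%:E)%E.
  apply: le_trans (shadow_event_prob genS delta_ge0 four_point C00 CD sch wr (ltW b0) b1
    iidX (mass _ mumu0) _ _ ul) _.
  by rewrite lee_fin; apply: powB1_le_expR; rewrite // ltW.
have PL : (P LB <= (2 * expR (- (eta * (M / q))))%:E)%E.
  have wr' i : size (rev (w i)) = r by rewrite size_rev.
  have mass' i : (beta%:E <= \prod_(a <- rev (w i)) mu [set a])%E.
    rewrite (perm_big (w i)) ?perm_rev //; exact: mass.
  have sch' : schottky (S := S) (fun i => \prod_(a <- rev (w i)) a^-1)%g C0 D.
    have -> // : (fun i => \prod_(a <- rev (w i)) a^-1)%g = (fun i => (\prod_(a <- w i) a)^-1)%g.
    apply/funext => i; elim: (w i) => [|x l IH]; first by rewrite /rev !big_nil invg1.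
    by rewrite rev_cons -cats1 big_cat big_seq1 IH /= big_cons invgM.
  apply: le_trans (shadow_event_prob genS delta_ge0 four_point C00 CD sch' wr' (ltW b0) b1
    iidX mass' _ _ ul') _.
  by rewrite lee_fin; apply: powB1_le_expR; rewrite // ltW.
have mRB : measurable RB by exact: (measurable_sampled e_surj).
have mLB : measurable LB by exact: (measurable_sampled e_surj).
have mJ : measurable J by exact: measurable_jump_pair.
have : (P E <= P RB + P LB + P J)%E.
  apply: (@le_trans _ _ (P ((RB `|` LB) `|` J))).
    by apply: le_measure; rewrite ?inE //; do ?apply: measurableU.
  apply: le_trans (measureU2 _ _ _) _ => //; first exact: measurableU.
  by rewrite leeD2r // measureU2.
move=> /le_trans; apply; apply: leeD.
  apply: le_trans (leeD PR PL) _; rewrite -EFinD lee_fin.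
  have : expR (- (eta * (M / q))) <= expR (- M / C).
    rewrite ler_expR mulNr lerN2 mulrCA ler_wpM2l ?(ltW M0) //.
    by rewrite -[eta / q]invf_div lef_pV2 ?posrE // /C; lra.
  have : 0 <= expR (- M / C) by exact: expR_ge0.
  have C4 : 4 <= C by rewrite /C; lra.
  by move=> y0 xy; have := ler_wpM2r y0 C4; lra.
apply: le_trans PJ _; rewrite lee_wpmul2r //; first by rewrite expe2 mule_ge0.
rewrite lee_fin.
have l1N : (size (take N (rev l1)))%:R <= M.
  by apply: le_trans NM; rewrite ler_nat size_take_min geq_minl.
have l2N : (size (take N l2))%:R <= M.
  by apply: le_trans NM; rewrite ler_nat size_take_min geq_minl.
by rewrite expr2 ler_pM.
Qed.

(** Geodesics cost a shift of t by [2 * delta + 2], absorbed in the constant; enlarging the constant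
    also enlarges exp(-M/C). *)
Lemma geodesic_deviation_tail : exists2 C : R, 1 <= C &
  forall mu, neighborhood mu0 1 mu ->
  forall (d : measure_display) (Omega : measurableType d)
    (P : probability Omega R) (X : nat -> {mfun Omega >-> discrete G}),
    iid_of_law P mu X ->
    forall (t M : R) (k n : nat), 1 <= M -> (k <= n)%N ->
      (P [set omega | t%:E <= geodesic_deviation R S (walk X k omega) 1%g (walk X n omega)]
       <= (C * expR (- M / C))%:E + (M ^+ 2)%:E *
          (P [set omega | ((t - C) / M <= len (X 0%N omega))%R]) ^+ 2)%E.
Proof.
have [C C1 HC] := gromov_product_tail; have d0 := delta_ge0.
exists (C + (2 * delta + 2)); first by lra.
move=> mu mumu0 d Omega P X iidX t M k n M1 kn.
have [mE PE] := HC mu mumu0 d Omega P X iidX (t - (2 * delta + 2)) M k n M1 kn.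
have [e e_surj] := generated_enum genS.
apply: (@le_trans _ _ (P [set omega |
    (t - (2 * delta + 2) <= gp (walk X k omega) 1%g (walk X n omega))%R])).
  apply: le_measure; rewrite ?inE //.
    have -> : [set omega | t%:E <= geodesic_deviation R S (walk X k omega) 1%g (walk X n omega)]%E =
        sampled X (iota 0 n) [set s | t%:E <=
          geodesic_deviation R S (\prod_(a <- take k s) a)%g 1%g (\prod_(a <- s) a)%g]%E.
      apply/seteqP; split => omega; rewrite /sampled /= !walkE -map_take take_iota;
        rewrite (minn_idPl kn) => H; exact: H.
    exact: (measurable_sampled e_surj).
  move=> omega /= /le_trans/(_ (geodesic_deviation_le genS four_point _ _ _)).
  by rewrite lee_fin lerBlDr.
apply: le_trans PE _; rewrite -addrA -opprD (addrC (2 * delta + 2)).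
apply: leeD => //; rewrite lee_fin; apply: ler_pM; rewrite ?expR_ge0 //; [lra|lra|].
by rewrite ler_expR !mulNr lerN2 ler_wpM2l ?lef_pV2 ?posrE //; lra.
Qed.

End tail.

(** * Moments *)

Section moments_from_tails.
Context {R : realType} {d : measure_display} {Omega : measurableType d}.
Variable P : probability Omega R.

(** For j the integer part of ln y, y < exp(j + 1), so the j-th layer alone dominates y^p; the
    summand 1 covers y < 1. *)
Lemma powR_le_exp_layers (p y : R) : 0 < p -> 0 <= y ->
  ((y `^ p)%:E <= 1 + \sum_(j <oo)
     (expR (j.+1%:R * p))%:E * (\1_[set z | expR j%:R <= z] y)%:E)%E.
Proof.
move=> p0 y0; have term0 (j : nat) :
    (0 <= (expR (j.+1%:R * p))%:E * (\1_[set z | (expR j%:R <= z)%R] y)%:E)%E.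
  by rewrite mule_ge0 ?lee_fin ?expR_ge0.
have [y1|y1] := ltP y 1.
  rewrite -[leLHS]adde0; apply: leeD; last exact: nneseries_ge0.
  rewrite lee_fin (_ : 1 = 1 `^ p); last by rewrite powR1.
  by apply: ge0_ler_powR; rewrite ?nnegrE //; lra.
have y_gt0 : 0 < y by lra.
have ly0 : 0 <= ln y by exact: ln_ge0.
pose j := Num.truncn (ln y).
have /andP[jl lj] : j%:R <= ln y < j.+1%:R by exact: Num.Theory.truncn_itv.
rewrite -[leLHS]add0e; apply: leeD; first by rewrite lee_fin.
have := @nneseries_lim_ge R (fun j => (expR (j.+1%:R * p))%:E *
  (\1_[set z | (expR j%:R <= z)%R] y)%:E)%E xpredT 0 j.+1 (fun n _ _ => term0 n).
apply: le_trans; rewrite big_nat_recr //= -[leLHS]add0e; apply: leeD; first exact: sume_ge0.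
rewrite indicE mem_set /=; last by rewrite -[leRHS](lnK y_gt0) ler_expR.
rewrite mule1 lee_fin expRM; apply: ge0_ler_powR; rewrite ?nnegrE ?expR_ge0 ?(ltW p0) //.
by rewrite -[leLHS](lnK y_gt0) ler_expR ltW.
Qed.

Lemma integral_powR_le_layers (p : R) (Y : Omega -> R) : 0 < p ->
    (forall omega, 0 <= Y omega) ->
    measurable_fun setT (fun omega => Y omega `^ p) ->
    (forall t, measurable [set omega | t <= Y omega]) ->
  (\int[P]_omega (Y omega `^ p)%:E <= 1 + \sum_(j <oo)
     (expR (j.+1%:R * p))%:E * P [set omega | (expR j%:R <= Y omega)%R])%E.
Proof.
move=> p0 Y0 mY mYt.
pose f (j : nat) omega : \bar R :=
  ((expR (j.+1%:R * p))%:E * (\1_[set w | (expR j%:R <= Y w)%R] omega)%:E)%E.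
have f0 j omega : (0 <= f j omega)%E by rewrite mule_ge0 ?lee_fin ?expR_ge0.
have mf j : measurable_fun [set: Omega] (f j).
  by apply: measurable_funeM; apply/measurable_EFinP; exact: measurable_indic.
have mser : measurable_fun [set: Omega] (fun omega => \sum_(j <oo) f j omega)%E.
  by apply: (ge0_emeasurable_sum (P := xpredT)) => j *; [exact: f0|exact: mf].
have mY' : measurable_fun [set: Omega] (fun omega => (Y omega `^ p)%:E).
  exact/measurable_EFinP.
apply: (@le_trans _ _ (\int[P]_omega (1 + \sum_(j <oo) f j omega))%E).
  apply: ge0_le_integral => //.
  - by move=> omega _; rewrite lee_fin powR_ge0.
  - exact: (emeasurable_funD (measurable_cst _) mser).
  - by move=> omega _; exact: powR_le_exp_layers.
rewrite ge0_integralD //; last by move=> omega _; exact: nneseries_ge0.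
rewrite integral_cst // [X in (1 * X)%E]probability_setT mule1 leeD2l //.
rewrite integral_nneseries //; apply: lee_nneseries => [j _ _|j _].
  exact: integral_ge0.
rewrite /f ge0_integralZl_EFin ?expR_ge0 //; last first.
  by apply/measurable_EFinP; exact: measurable_indic.
by rewrite integral_indic // setIT.
Qed.

End moments_from_tails.

Lemma nneseries_geometric_lty {R : realType} (B z : R) : 0 <= B -> 0 <= z -> z < 1 ->
  (\sum_(j <oo) (B * z ^+ j)%:E <= (B / (1 - z))%:E)%E.
Proof.
move=> B0 z0 z1; apply: lime_le.
  by apply: is_cvg_nneseries => j _ _; rewrite lee_fin mulr_ge0 // exprn_ge0.
apply: nearW => n; rewrite sumEFin lee_fin big_mkord -mulr_sumr ler_wpM2l //.
rewrite -[leRHS]mul1r ler_pdivlMr ?subr_gt0 //.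
have := subrX1 z n; have := exprn_ge0 n z0; lra.
Qed.

Section second_moment.
Context {R : realType} {G : groupType} {S : seq G}.
Hypothesis genS : generates S.
Local Notation len g := ((word_length S g)%:R : R).

Lemma second_moment_tail (mu : probability (discrete G) R) : finite_moment S 2 mu ->
  exists2 m : R, 0 <= m & forall s : R, 0 < s ->
    (mu [set x | (s <= len x)%R] <= (m / s ^+ 2)%:E)%E.
Proof.
rewrite /finite_moment => fin2; have [e e_surj] := generated_enum genS.
pose F (x : discrete G) : \bar R := (len x ^+ 2)%:E.
have F0 x : (0 <= F x)%E by rewrite lee_fin sqr_ge0.
have IE : (\int[mu]_x F x)%E =
    (\esum_(x in [set: G]) (((word_dist S 1%g x)%:R `^ 2)%:E * mu [set x]))%E.
  rewrite (integral_esum e_surj) //; apply: eq_esum => x _; congr (_ * _)%E.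
  by rewrite /F /word_dist invg1 mul1g powR_mulrn.
have Ifin : (\int[mu]_x F x)%E \is a fin_num.
  by rewrite ge0_fin_numE ?IE // -IE integral_ge0.
exists (fine (\int[mu]_x F x)%E); first by rewrite fine_ge0 // integral_ge0.
move=> s s0; pose A : set (discrete G) := [set x | s <= len x].
rewrite EFinM fineK // lee_pdivlMr ?exprn_gt0 // muleC.
rewrite -integral_cst //; apply: (@le_trans _ _ (\int[mu]_(x in A) F x)%E).
  apply: ge0_le_integral => // [x _|x Ax]; first by rewrite lee_fin sqr_ge0.
  by rewrite lee_fin lerXn2r ?nnegrE // ltW.
exact: ge0_subset_integral.
Qed.

End second_moment.

(** [q] is the tail of the Gromov product at exp(j) and [x] that of one increment at [s]. As [x] is
    of order (j + 1)^2 exp(-2j), the product M^2 x^2 is of order (j + 1)^6 exp(-4j). *)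
Lemma layer_decay {R : realType} (C m x q : R) (j : nat) :
    1 <= C -> 0 <= m -> 0 <= x -> q <= 1 ->
    q <= C * expR (- (4 * j.+1%:R)) + (4 * C * j.+1%:R) ^+ 2 * x ^+ 2 ->
    (forall s, s = (expR j%:R - C) / (4 * C * j.+1%:R) -> 0 < s -> x <= m / s ^+ 2) ->
  q <= (C + 16 * 64 ^+ 2 * C ^+ 6 * m ^+ 2 + 16 * C ^+ 4) * (j.+1%:R ^+ 6 * expR (- (4 * j%:R))).
Proof.
move=> C1 m0 x0 q1 qle xle; set u : R := j.+1%:R in qle xle *.
have u1 : 1 <= u by rewrite ler1n.
set E := expR j%:R in xle *; have E0 : 0 < E := expR_gt0 _.
have yE : expR (- (4 * j%:R)) = E^-1 ^+ 4.
  by rewrite expRN exprVn expRM_natl.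
have e4 : expR (- (4 * u)) <= E^-1 ^+ 4.
  by rewrite -yE ler_expR lerN2 ler_pM2l // ler_nat.
rewrite yE; set y := E^-1 in e4 *; have y0 : 0 < y by rewrite invr_gt0.
have u6 : 1 <= u ^+ 6 by exact: exprn_ege1.
have y4 : 0 <= y ^+ 4 by rewrite exprn_ge0 // ltW.
have uy : y ^+ 4 <= u ^+ 6 * y ^+ 4 by rewrite ler_peMl.
have C4 : 0 <= C ^+ 4 by rewrite exprn_ge0 //; lra.
have C0 : 0 <= C by lra.
have C6m : 0 <= 16 * 64 ^+ 2 * C ^+ 6 * m ^+ 2 by rewrite !mulr_ge0 ?exprn_ge0.
(* For small j, q <= 1 <= (2 C exp(-j))^4 accounts for the term 16 C^4; otherwise exp(j) - C >=
   exp(j) / 2. *)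
have [EC|CE] := ltP E (2 * C).
  apply: le_trans q1 _; have : 1 <= (2 * C * y) ^+ 4.
    by rewrite exprn_ege1 // ler_pdivlMr // mul1r ltW.
  rewrite !exprMn => yC.
  have := ler_wpM2l C4 uy.
  have : 0 <= (C + 16 * 64 ^+ 2 * C ^+ 6 * m ^+ 2) * (u ^+ 6 * y ^+ 4).
    by apply: mulr_ge0 (le_trans y4 uy); apply: addr_ge0.
  lra.
have s0 : 0 < (E - C) / (4 * C * u) by rewrite divr_gt0 ?mulr_gt0 //; lra.
have := xle _ erefl s0; set s := (E - C) / _ in s0 * => {}xle.
have sy : s^-1 <= 8 * C * u * y.
  rewrite /s invf_div ler_pdivrMr; last by lra.
  have yE1 : C * u * (y * E) = C * u by rewrite mulVf ?mulr1 // gt_eqF.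
  have Cy : 2 * C * y <= 1 by rewrite ler_pdivrMr // mul1r.
  have : 0 <= (1 - 2 * C * y) * (C * u) by rewrite mulr_ge0 ?subr_ge0 // mulr_ge0 //; lra.
  lra.
have xb : x <= m * (8 * C * u * y) ^+ 2.
  apply: le_trans xle _; rewrite ler_wpM2l // -exprVn lerXn2r ?nnegrE //.
    by rewrite invr_ge0 ltW.
  by rewrite !mulr_ge0 //; lra.
have x2 : x ^+ 2 <= (m * (8 * C * u * y) ^+ 2) ^+ 2.
  by rewrite lerXn2r ?nnegrE // (le_trans x0).
apply: le_trans qle _.
have := ler_wpM2l (sqr_ge0 (4 * C * u)) x2.
have -> : (4 * C * u) ^+ 2 * (m * (8 * C * u * y) ^+ 2) ^+ 2 =
  16 * 64 ^+ 2 * C ^+ 6 * m ^+ 2 * (u ^+ 6 * y ^+ 4) by ring.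
have := ler_wpM2l C0 (le_trans e4 uy).
have : 0 <= C ^+ 4 * (u ^+ 6 * y ^+ 4) by rewrite mulr_ge0 // (le_trans y4).
lra.
Qed.

(** Half of the gap 4 - p absorbs the polynomial, by u <= exp(c u) / c with 6 c = (4 - p) / 2; the
    other half is the geometric rate. *)
Lemma poly_exp_geometric {R : realType} (p : R) (j : nat) : p < 4 ->
  expR (j.+1%:R * p) * (j.+1%:R ^+ 6 * expR (- (4 * j%:R))) <=
  ((4 - p) / 12)^-1 ^+ 6 * expR (p + (4 - p) / 2) * expR (- ((4 - p) / 2)) ^+ j.
Proof.
move=> p4; set c := (4 - p) / 12; set u : R := j.+1%:R.
have c0 : 0 < c by rewrite /c; lra.
have uc : u <= c^-1 * expR (c * u).
  rewrite mulrC ler_pdivlMr // mulrC; apply: le_trans (expR_ge1Dx _); lra.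
have u6 : u ^+ 6 <= (c^-1 * expR (c * u)) ^+ 6.
  by rewrite lerXn2r ?nnegrE ?(le_trans _ uc).
have e0 : 0 <= expR (u * p) * expR (- (4 * j%:R)) by rewrite mulr_ge0 ?expR_ge0.
rewrite mulrCA [leLHS]mulrC; apply: le_trans (ler_wpM2l e0 u6) _.
rewrite exprMn -!expRM_natl mulrCA -[leRHS]mulrA ler_wpM2l ?exprn_ge0 ?invr_ge0 ?(ltW c0) //.
by rewrite -!expRD ler_expR /c /u -natr1; lra.
Qed.

Lemma moment_deviation_of_tail {R : realType} {G : groupType} {S : seq G}
    (genS : generates S) (C : R) (mu : probability (discrete G) R)
    (d : measure_display) (Omega : measurableType d)
    (P : probability Omega R) (X : nat -> {mfun Omega >-> discrete G}) :
    1 <= C -> iid_of_law P mu X ->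
    (forall (t M : R) (k n : nat), 1 <= M -> (k <= n)%N ->
      measurable [set omega |
        t <= gromov_product R S (walk X k omega) 1%g (walk X n omega)] /\
      (P [set omega | (t <= gromov_product R S (walk X k omega) 1%g (walk X n omega))%R]
       <= (C * expR (- M / C))%:E + (M ^+ 2)%:E *
          (P [set omega | ((t - C) / M <= (word_length S (X 0%N omega))%:R)%R]) ^+ 2)%E) ->
    finite_moment S 2 mu ->
  forall p : R, 0 < p -> p < 4 -> moment_deviation_inequality P X S p.
Proof.
move=> C1 iidX tail /(second_moment_tail genS) [m m0 mP] p p0 p4.
have [e e_surj] := generated_enum genS.
pose B1 := C + 16 * 64 ^+ 2 * C ^+ 6 * m ^+ 2 + 16 * C ^+ 4.
pose B2 := ((4 - p) / 12)^-1 ^+ 6 * expR (p + (4 - p) / 2).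
pose z := expR (- ((4 - p) / 2)).
have B1_ge0 : 0 <= B1 by rewrite !addr_ge0 ?mulr_ge0 ?exprn_ge0 //; lra.
have B2_ge0 : 0 <= B2 by rewrite mulr_ge0 ?expR_ge0 ?exprn_ge0 // invr_ge0; lra.
have z1 : z < 1 by rewrite /z expR_lt1; lra.
have z0 : 0 <= z by exact: expR_ge0.
rewrite /moment_deviation_inequality.
apply: (@le_lt_trans _ _ (1 + B1 * B2 / (1 - z))%:E); last exact: ltry.
apply: ge_ereal_sup => _ [[n l] _ <-] /=; rewrite unlock.
set Y := fun omega => gromov_product R S (walk X n omega) 1%g (walk X (n + l)%N omega).
have nl : (n <= n + l)%N by exact: leq_addr.
have Y0 omega : 0 <= Y omega by exact: gp_ge0.
have YE : Y = fun omega => gromov_product R S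
    (\prod_(a <- take n [seq (X i omega : G) | i <- iota 0 (n + l)]) a)%g 1%g
    (\prod_(a <- [seq (X i omega : G) | i <- iota 0 (n + l)]) a)%g.
  apply/funext => omega; rewrite /Y !walkE -map_take take_iota (minn_idPl nl).
  by [].
have mY : measurable_fun setT (fun omega => Y omega `^ p).
  rewrite YE; exact: (measurable_fun_sampled e_surj X (iota 0 (n + l)) (fun s =>
    gromov_product R S (\prod_(a <- take n s) a)%g 1%g (\prod_(a <- s) a)%g `^ p)).
have mYt t : measurable [set omega | t <= Y omega] by have [] := tail t 1 n (n + l)%N (lexx _) nl.
apply: le_trans (integral_powR_le_layers P p0 Y0 mY mYt) _.
rewrite EFinD leeD2l //.
apply: le_trans (nneseries_geometric_lty (mulr_ge0 B1_ge0 B2_ge0) z0 z1).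
apply: lee_nneseries => [j _ _|j _]; first by rewrite mule_ge0 ?lee_fin ?expR_ge0.
(* This M turns exp(-M/C) into exp(-4(j + 1)), which beats exp(j p) for every p < 4, while M^2 stays
   polynomial in j. *)
set A := [set omega | _]; pose M := 4 * C * j.+1%:R.
have j1 : 1 <= j.+1%:R :> R by rewrite ler1n.
have M1 : 1 <= M by rewrite /M; nra.
pose s := (expR j%:R - C) / M.
pose T := [set omega | (s <= (word_length S (X 0%N omega))%:R)%R].
have [mA PA] := tail (expR j%:R) M n (n + l)%N M1 nl.
rewrite -/A -/T in mA PA.
have mT : measurable T.
  exact: (measurable_preimage_X X 0 [set x | (s <= (word_length S x)%:R)%R]).
have Afin : P A \is a fin_num by exact: fin_num_measure.
have Tfin : P T \is a fin_num by exact: fin_num_measure.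
have TE : P T = mu [set x | (s <= (word_length S x)%:R)%R].
  by have [_ law] := iidX; exact: law.
have q1 : fine (P A) <= 1 by rewrite -lee_fin fineK // probability_le1.
have x0 : 0 <= fine (P T) by exact: fine_ge0.
have MC : - M / C = - (4 * j.+1%:R).
  by rewrite /M; field; rewrite gt_eqF //; lra.
have qle : fine (P A) <= C * expR (- (4 * j.+1%:R)) + M ^+ 2 * fine (P T) ^+ 2.
  by move: PA; rewrite MC -(fineK Afin) -(fineK Tfin) -EFin_expe -EFinM -EFinD lee_fin.
have xle s' : s' = (expR j%:R - C) / M -> 0 < s' -> fine (P T) <= m / s' ^+ 2.
  by move=> -> sp; have := mP _ sp; rewrite -TE -(fineK Tfin) lee_fin.
have dec := layer_decay C1 m0 x0 q1 qle xle.
rewrite -(fineK Afin) -EFinM lee_fin.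
apply: le_trans (ler_wpM2l (expR_ge0 _) dec) _.
rewrite mulrCA -(mulrA B1) ler_wpM2l //; exact: poly_exp_geometric.
Qed.

Theorem theorem11p1 (R : realType) (G : groupType) (S : seq G)
    (genS : generates S) (hypS : gromov_hyperbolic R S)
    (mu0 : probability (discrete G) R)
    (mom1 : finite_moment S 1 mu0)
    (nonelem : nonelementary (semigroup_generated (msupport mu0))) :
  exists K C : R, [/\ 0 < K, 1 <= C &
    forall mu, neighborhood mu0 K mu ->
    forall (d : measure_display) (Omega : measurableType d)
      (P : probability Omega R) (X : nat -> {mfun Omega >-> discrete G}),
      iid_of_law P mu X ->
      (forall (t M : R) (k n : nat), 0 <= t -> 1 <= M ->
         (0 < k)%N -> (k <= n)%N ->
         (P [set omega | t%:E <=
               geodesic_deviation R S (walk X k omega) 1%g (walk X n omega)]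
          <= (C * expR (- M / C))%:E
             + (M ^+ 2)%:E *
               (P [set omega |
                     ((t - C) / M <= (word_dist S 1%g (X 0%N omega))%:R)%R]) ^+ 2)%E)
      /\
      (finite_moment S 2 mu ->
       forall p : R, 0 < p -> p < 4 -> moment_deviation_inequality P X S p)].
Proof.
have [delta [delta_ge0 four_point]] := hyperbolic_delta hypS.
have [C C1 HC] := geodesic_deviation_tail genS delta_ge0 four_point nonelem.
have [C' C'1 HC'] := gromov_product_tail genS delta_ge0 four_point nonelem.
(* The moments use the tail of the Gromov product itself, with its own constant [C']. *)
exists 1, C; split=> // mu mumu0 d Omega P X iidX; split.
  move=> t M k n _ M1 _ kn.
  have := HC mu mumu0 d Omega P X iidX t M k n M1 kn.
  rewrite (_ : [set omega | ((t - C) / M <= (word_dist S 1%g (X 0%N omega))%:R)%R] =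
    [set omega | ((t - C) / M <= (word_length S (X 0%N omega))%:R)%R]) //.
  by apply/seteqP; split=> omega; rewrite /= /word_dist invg1 mul1g.
exact: (moment_deviation_of_tail genS C'1 iidX (HC' mu mumu0 d Omega P X iidX)).
Qed.
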